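(* All generalized Clifford tori $M_{p,q}\subset S^{p+q+1}$ ($1\le p\le q$) and all Veronese $n$-manifolds ($n\ge 2$) are compact minimal submanifolds of unit Euclidean spheres which are SCDK-ideal; that is, with $n$ the dimension of the submanifold, $m$ its codimension in the sphere and $\lambda_1\ge\cdots\ge\lambda_m$ the eigenvalues of its fundamental matrix at each point, they satisfy $$\sum_{\alpha=1}^{\min\{n,m\}}\lambda_\alpha+\lambda_2\equiv n.$$
   Context: For a submanifold $M^n\subset S^{n+m}$ of the unit sphere with Levi-Civita connection $\overline\nabla$ of the sphere, the second fundamental form is $B_{XY}=(\overline\nabla_XY)^N$ (normal component); $M$ is minimal if the trace of $B$ vanishes identically. At $x\in M$, with $e_1,\dots,e_n$ and $\nu_1,\dots,\nu_m$ orthonormal bases of $T_xM$ and $N_xM$, the fundamental matrix is $(S_{\alpha\beta})$, $S_{\alpha\beta}=\sum_{i,j}\langle B_{e_ie_j},\nu_\alpha\rangle\langle B_{e_ie_j},\nu_\beta\rangle$; its eigenvalues do not depend on the bases. Convention: $\lambda_\alpha:=0$ for $\alpha>m$. A minimal submanifold $M^n\subset S^{n+m}$ is called SCDK-ideal (Simons–Chern–do Carmo–Kobayashi ideal) if $\sum_{\alpha=1}^{\min\{n,m\}}\lambda_\alpha+\lambda_2\equiv n$ on $M$. Let $S^q(r)\subset\mathbb R^{q+1}$ be the sphere of radius $r$ centered at the origin. The generalized Clifford torus is $M_{p,q}=S^p\big(\sqrt{p/(p+q)}\big)\times S^q\big(\sqrt{q/(p+q)}\big)\subset S^{p+q+1}\subset\mathbb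 R^{p+q+2}$, embedded by $(x,y)\mapsto(x,y)$, of dimension $n=p+q$. Let $\mathrm{Sym}_{n+1}^0$ be the space of traceless real symmetric $(n+1)\times(n+1)$ matrices with inner product $\langle A,B\rangle=\operatorname{tr}(AB^T)$, of dimension $\frac{n(n+3)}2$. The Veronese $n$-manifold is the (immersed) submanifold of the unit sphere of $\mathrm{Sym}_{n+1}^0$ given by the isometric immersion $$\psi:S^n\Big(\sqrt{\tfrac{2(n+1)}n}\Big)\to\mathrm{Sym}_{n+1}^0,\qquad \psi(x)=\tfrac12\sqrt{\tfrac n{n+1}}\Big(xx^T-\tfrac2nI_{n+1}\Big)$$ ($x$ a column vector). *)

(* Defs.v *)
From HB Require Import structures.
From mathcomp Require Import all_boot all_order all_algebra.
From mathcomp Require Import all_classical all_reals all_analysis.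

Set Implicit Arguments.
Unset Strict Implicit.
Unset Printing Implicit Defensive.

Import Order.TTheory GRing.Theory Num.Theory.
Import numFieldNormedType.Exports.

Local Open Scope classical_set_scope.
Local Open Scope ring_scope.

(* On column vectors this is the standard inner product; on square matrices it
   is the trace product. *)
Definition dot (R : realType) (k l : nat) (A B : 'M[R]_(k, l)) : R :=
  \tr (A *m B^T).

(* C^infinity on U: every iterated directional derivative is differentiable.
   Only used for open U, where these derivatives depend on f on U alone. *)
Definition smooth_on (R : realType) (V W : normedModType R)
    (U : set V) (f : V -> W) : Prop :=
  forall (vs : seq V) (x : V), U x ->
    differentiable (foldr (fun v g => 'D_v g) f vs) x.

(* phi restricted to the open set U is a local parametrization of X: a smooth
   immersion which is a homeomorphism onto a relatively open subset of X. *)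
Definition parametrization (R : realType) (W : normedModType R) (n : nat)
    (X : set W) (U : set 'cV[R]_n) (phi : 'cV[R]_n -> W) : Prop :=
  [/\ open U,
      smooth_on U phi,
      forall u, U u -> injective ('d phi u : 'cV[R]_n -> W),
      {in U &, injective phi} &
      forall O : set 'cV[R]_n, open O -> O `<=` U ->
        exists2 O' : set W, open O' & phi @` O = X `&` O'].

Definition embedded_manifold (R : realType) (W : normedModType R) (n : nat)
    (X : set W) : Prop :=
  forall x, X x -> exists (U : set 'cV[R]_n) (phi : 'cV[R]_n -> W),
    parametrization X U phi /\ (phi @` U) x.

(* F immerses the n-manifold X in the unit sphere S^(n+m) of the Euclidean
   space E. An embedded submanifold X is the case F = idfun. *)
Definition immersed_submanifold (R : realType) (W : normedModType R)
    (k l n m : nat) (E : {vspace 'M[R]_(k, l)}) (X : set W)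
    (F : W -> 'M[R]_(k, l)) : Prop :=
  [/\ \dim E = (n + m).+1,
      embedded_manifold n X,
      forall x, X x -> F x \in E /\ dot (F x) (F x) = 1 &
      forall (U : set 'cV[R]_n) (phi : 'cV[R]_n -> W),
        parametrization X U phi ->
        smooth_on U (F \o phi) /\
        forall u, U u ->
          injective ('d (F \o phi) u : 'cV[R]_n -> 'M[R]_(k, l))].

(* In the definitions below f : 'cV_n -> E is an immersion into the unit sphere
   of E, i.e. the composite of an immersion F with a local parametrization;
   everything is taken at the point f u of the submanifold. *)

Definition tangent_space (R : realType) (k l n : nat)
    (f : 'cV[R]_n -> 'M[R]_(k, l)) (u : 'cV[R]_n) : set 'M[R]_(k, l) :=
  range ('d f u : 'cV[R]_n -> 'M[R]_(k, l)).

(* The normal space within the sphere, whence the orthogonality to f u. *)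
Definition normal_space (R : realType) (k l n : nat)
    (E : {vspace 'M[R]_(k, l)}) (f : 'cV[R]_n -> 'M[R]_(k, l))
    (u : 'cV[R]_n) : set 'M[R]_(k, l) :=
  [set v | [/\ v \in E, dot v (f u) = 0 &
               forall w, tangent_space f u w -> dot v w = 0]].

Definition normal_part (R : realType) (k l n : nat)
    (E : {vspace 'M[R]_(k, l)}) (f : 'cV[R]_n -> 'M[R]_(k, l))
    (u : 'cV[R]_n) (w : 'M[R]_(k, l)) : 'M[R]_(k, l) :=
  xget 0 [set b | normal_space E f u b /\ tangent_space f u (w - b)].

(* Levi-Civita connection of the unit sphere, for a field Y along f tangent to
   the sphere: the flat derivative along 'd f u v, projected onto the tangent
   space of the sphere at f u. *)
Definition sphere_nabla (R : realType) (k l n : nat)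
    (f : 'cV[R]_n -> 'M[R]_(k, l)) (v : 'cV[R]_n)
    (Y : 'cV[R]_n -> 'M[R]_(k, l)) (u : 'cV[R]_n) : 'M[R]_(k, l) :=
  'D_v Y u - dot ('D_v Y u) (f u) *: f u.

(* X and Y are vector fields on the parameter domain, standing for the tangent
   fields u |-> 'd f u (X u) and u |-> 'd f u (Y u) of the submanifold. *)
Definition second_fundamental_form (R : realType) (k l n : nat)
    (E : {vspace 'M[R]_(k, l)}) (f : 'cV[R]_n -> 'M[R]_(k, l))
    (X Y : 'cV[R]_n -> 'cV[R]_n) (u : 'cV[R]_n) : 'M[R]_(k, l) :=
  normal_part E f u (sphere_nabla f (X u) (fun w => 'd f w (Y w)) u).

Definition orthonormal_basis (R : realType) (k l d : nat)
    (A : set 'M[R]_(k, l)) (b : 'I_d -> 'M[R]_(k, l)) : Prop :=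
  [/\ forall i, A (b i),
      forall i j, dot (b i) (b j) = (i == j)%:R &
      forall v, A v -> exists c : 'I_d -> R, v = \sum_i c i *: b i].

(* Smooth tangent fields on U that are orthonormal at u (only). *)
Definition tangent_frame (R : realType) (k l n : nat)
    (f : 'cV[R]_n -> 'M[R]_(k, l)) (U : set 'cV[R]_n) (u : 'cV[R]_n)
    (e : 'I_n -> 'cV[R]_n -> 'cV[R]_n) : Prop :=
  (forall i, smooth_on U (e i)) /\
  orthonormal_basis (tangent_space f u) (fun i => 'd f u (e i u)).

Definition fundamental_matrix (R : realType) (k l n m : nat)
    (E : {vspace 'M[R]_(k, l)}) (f : 'cV[R]_n -> 'M[R]_(k, l))
    (u : 'cV[R]_n) (e : 'I_n -> 'cV[R]_n -> 'cV[R]_n)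
    (nu : 'I_m -> 'M[R]_(k, l)) : 'M[R]_m :=
  \matrix_(a, b) \sum_i \sum_j
    dot (second_fundamental_form E f (e i) (e j) u) (nu a) *
    dot (second_fundamental_form E f (e i) (e j) u) (nu b).

(* The eigenvalues of A with multiplicity, in nonincreasing order. *)
Definition spectrum (R : realType) (m : nat) (A : 'M[R]_m) (s : seq R) : Prop :=
  sorted >=%R s /\ char_poly A = \prod_(a <- s) ('X - a%:P).

Definition minimal_submanifold (R : realType) (W : normedModType R)
    (k l n m : nat) (E : {vspace 'M[R]_(k, l)}) (X : set W)
    (F : W -> 'M[R]_(k, l)) : Prop :=
  immersed_submanifold n m E X F /\
  forall (U : set 'cV[R]_n) (phi : 'cV[R]_n -> W) (u : 'cV[R]_n)
         (e : 'I_n -> 'cV[R]_n -> 'cV[R]_n),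
    parametrization X U phi -> U u -> tangent_frame (F \o phi) U u e ->
    \sum_i second_fundamental_form E (F \o phi) (e i) (e i) u = 0.

(* Eigenvalues are indexed from 0, so lambda_2 is s`_1; the default value of
   s`_a is 0, which is the convention for indices beyond m. *)
Definition SCDK_ideal (R : realType) (W : normedModType R)
    (k l n m : nat) (E : {vspace 'M[R]_(k, l)}) (X : set W)
    (F : W -> 'M[R]_(k, l)) : Prop :=
  minimal_submanifold n m E X F /\
  forall (U : set 'cV[R]_n) (phi : 'cV[R]_n -> W) (u : 'cV[R]_n)
         (e : 'I_n -> 'cV[R]_n -> 'cV[R]_n) (nu : 'I_m -> 'M[R]_(k, l)),
    parametrization X U phi -> U u -> tangent_frame (F \o phi) U u e ->
    orthonormal_basis (normal_space E (F \o phi) u) nu ->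
    exists2 s : seq R,
      spectrum (fundamental_matrix E (F \o phi) u e nu) s &
      \sum_(0 <= a < minn n m) s`_a + s`_1 = n%:R.

Definition sphere (R : realType) (q : nat) (r : R) : set 'cV[R]_q.+1 :=
  [set x | Num.sqrt (dot x x) = r].
Arguments sphere {R} q r _.

(* R^(p+1) x R^(q+1) is identified with R^(p+q+2) by stacking columns. *)
Definition clifford_torus (R : realType) (p q : nat) :
    set 'cV[R]_(p.+1 + q.+1) :=
  [set col_mx x y | x in sphere p (Num.sqrt (p%:R / (p + q)%:R))
                  & y in sphere q (Num.sqrt (q%:R / (p + q)%:R))].
Arguments clifford_torus R p q _ : clear implicits.

Definition sym0 (R : realType) (n : nat) : {vspace 'M[R]_n} :=
  (lker (linfun (idfun \- @trmx R n n)) :&: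
   lker (linfun (mxtrace : 'M[R]_n -> R^o)))%VS.

Lemma mem_sym0 (R : realType) (n : nat) (A : 'M[R]_n) :
  A \in sym0 R n <-> A^T = A /\ \tr A = 0.
Proof.
rewrite memv_cap !memv_ker !lfunE /= subr_eq0.
by split=> [/andP[/eqP AE /eqP ->]|[-> ->]]; rewrite -?AE ?eqxx.
Qed.

Definition veronese_radius (R : realType) (n : nat) : R :=
  Num.sqrt ((2 * n.+1)%:R / n%:R).

Definition veronese (R : realType) (n : nat) (x : 'cV[R]_n.+1) :
    'M[R]_n.+1 :=
  (2^-1 * Num.sqrt (n%:R / n.+1%:R)) *: (x *m x^T - (2 / n%:R)%:M).
Arguments veronese R n x : clear implicits.

(* Main.v *)
Require Import Defs.
From HB Require Import structures.
From mathcomp Require Import all_boot all_order all_algebra.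
From mathcomp Require Import ring zify.
From mathcomp Require Import all_classical all_reals all_analysis.

Set Implicit Arguments.
Unset Strict Implicit.
Unset Printing Implicit Defensive.

Import Order.TTheory GRing.Theory Num.Theory.
Import numFieldNormedType.Exports.

Local Open Scope classical_set_scope.
Local Open Scope ring_scope.

(* In both cases the second fundamental form is read off by differentiating the
   equations of the manifold along a tangent field, and the fundamental matrix
   is computed as a trace, using that an orthonormal tangent frame completed by
   the normals is an orthogonal matrix.

   Torus: with s = sqrt (q / p) and Q = diag (s, -1/s) blockwise, M_{p,q} is
   {x | <x, x> = 1, <x, Q x> = 0}, its unit normal is Q x and
   B(v, w) = - <v, Q w> Q x. Since Q^2 = t Q + 1 and tr Q = t for t = s - 1/s,
   Q leaves span (x, Q x) invariant with trace t there, so its compression h to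
   the tangent space has tr h = 0 and tr h^2 = n.

   Veronese: with c = veronese_scale and P the orthogonal projection onto the
   orthogonal complement of x, the normal space consists of the traceless
   symmetric matrices killing x, and
   B(v, w) = c (v w^T + w v^T - (2 / n) <v, w> P), where tangent vectors are
   taken in the sphere. Hence the fundamental matrix is
   4 c^2 = n / (n + 1) times the identity, in codimension m >= n. *)

(** * Calculus in spaces of matrices *)

Lemma cvg_sum (R : realType) (V : normedModType R) (T : Type)
    (F : set_system T) (n : nat) (f : 'I_n -> T -> V) (a : 'I_n -> V)
    {FF : Filter F} :
  (forall i, f i x @[x --> F] --> a i) ->
  \sum_i f i x @[x --> F] --> \sum_i a i.
Proof.
by move=> fa; apply: cvg_big => [|i _]; [exact: add_continuous|exact: fa].
Qed.

Lemma cvg_mx (R : realType) (T : topologicalType) (m n : nat)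
    (f : T -> 'M[R]_(m, n)) (x : T) :
  (forall i j, f y i j @[y --> x] --> f x i j) -> f y @[y --> x] --> f x.
Proof.
move=> fc.
rewrite (_ : f = fun y => \sum_i \sum_j (f y i j *: delta_mx i j)); last first.
  by apply/funext => y; rewrite -matrix_sum_delta.
apply: (@cvg_sum _ _ _ _ _ _ _ (nbhs_filter x)) => i.
apply: (@cvg_sum _ _ _ _ _ _ _ (nbhs_filter x)) => j.
by apply: cvgZr_tmp; exact: fc.
Qed.

Lemma linear_mx_continuous (R : realType) (V : normedModType R) (m n : nat)
    (f : {linear 'M[R]_(m, n) -> V}) : continuous f.
Proof.
move=> x; rewrite /continuous_at.
rewrite (_ : (f : _ -> V) = fun y : 'M[R]_(m, n) =>
  \sum_i \sum_j (y i j *: f (delta_mx i j))); last first.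
  apply/funext => y; rewrite {1}(matrix_sum_delta y) linear_sum.
  apply: eq_bigr => i _; rewrite linear_sum; apply: eq_bigr => j _.
  by rewrite linearZ.
apply: (@cvg_sum _ _ _ _ _ _ _ (nbhs_filter x)) => i.
apply: (@cvg_sum _ _ _ _ _ _ _ (nbhs_filter x)) => j.
by apply: cvgZr_tmp; exact: coord_continuous.
Qed.

Lemma mulmx_continuous (R : realType) (m n p : nat) :
  continuous (fun x : 'M[R]_(m, n) * 'M[R]_(n, p) => x.1 *m x.2).
Proof.
move=> x; apply: cvg_mx => i j.
rewrite mxE; under eq_fun do rewrite mxE.
apply: (@cvg_sum _ _ _ _ _ _ _ (nbhs_filter x)) => k; apply: cvgM.
  apply: (@cvg_comp _ _ _ fst (fun y : 'M[R]_(m, n) => y i k)).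
    exact: cvg_fst.
  exact: coord_continuous.
apply: (@cvg_comp _ _ _ snd (fun y : 'M[R]_(n, p) => y k j)).
  exact: cvg_snd.
exact: coord_continuous.
Qed.

(** The difference [h] vanishes near [x], so the zero map is its differential there, and [g = f + h]
    inherits differentiability. *)
Lemma near_eq_differentiable (R : realType) (V W : normedModType R)
    (f g : V -> W) (x : V) :
  (\near x, f x = g x) -> differentiable f x -> differentiable g x.
Proof.
move=> fg df; pose h := g - f.
have h0 : h \o shift x = cst (h x) + (0 : V -> W) +o_ 0 id.
  apply/eqaddoP => _ /posnumP[e]; near=> y.
  have -> : (h \o shift x - (cst (h x) + (0 : V -> W))) y = 0.
    rewrite !fctE /= addr0 /h !fctE.
    rewrite (nbhs_singleton fg) subrr subr0.
    have -> : f (y + x) = g (y + x).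
      near: y; move: fg; rewrite (near_shift 0 x).
      by apply: filterS => y /=; rewrite subr0.
    by rewrite subrr.
  by rewrite normr0 mulr_ge0.
have -> : g = f + h by apply/funext => y; rewrite !fctE addrC subrK.
apply: differentiableD => //; apply/diff_locallyP.
have c0 : continuous (0 : V -> W) by move=> y; exact: cvg_cst.
have dh : 'd h x = 0 :> (V -> W) by exact/diff_unique.
by rewrite dh; split.
Unshelve. all: by end_near. Qed.

Lemma derive_lin (R : realType) (V W Z : normedModType R)
    (L : {linear W -> Z}) (f : V -> W) (x v : V) :
  continuous L -> differentiable f x -> 
  differentiable (fun y => L (f y)) x /\
  'D_v (fun y => L (f y)) x = L ('D_v f x).
Proof.
move=> cL df.
have dL : differentiable L (f x) by exact: linear_differentiable.
have dLf : differentiable (L \o f) x by exact: differentiable_comp.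
by split=> //; rewrite !deriveE// (diff_comp df dL) diff_lin.
Qed.

Lemma derive_bilin (R : realType) (V W1 W2 Z : normedModType R)
    (b : {bilinear W1 -> W2 -> Z}) (f : V -> W1) (g : V -> W2) (x v : V) :
  continuous (fun p => b p.1 p.2) -> differentiable f x -> differentiable g x ->
  differentiable (fun y => b (f y) (g y)) x /\
  'D_v (fun y => b (f y) (g y)) x = b ('D_v f x) (g x) + b (f x) ('D_v g x).
Proof.
move=> cb df dg.
have db := @differentiable_bilin _ _ _ _ b (f x, g x) cb.
have dfg := differentiable_pair df dg.
have dbfg : differentiable ((fun p => b p.1 p.2) \o (fun y => (f y, g y))) x
  by exact: differentiable_comp.
split=> //; rewrite !deriveE// (diff_comp dfg db) diff_bilin//.
by rewrite diff_pair//= addrC.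
Qed.

(* smooth_on stratified by the order of differentiation, so that products and
   inverses can be treated by induction on k. Here k = 0 already asks for
   differentiability. *)
Fixpoint Ck_on (R : realType) (V W : normedModType R) (k : nat) (U : set V)
    (f : V -> W) : Prop :=
  (forall x, U x -> differentiable f x) /\
  if k is k'.+1 then forall v, Ck_on k' U ('D_v f) else True.

Lemma Ck_on_differentiable (R : realType) (V W : normedModType R) (k : nat)
    (U : set V) (f : V -> W) (x : V) :
  Ck_on k U f -> U x -> differentiable f x.
Proof. by case: k => [|k] [df _]; exact: df. Qed.

Lemma Ck_onW (R : realType) (V W : normedModType R) (k : nat)
    (U : set V) (f : V -> W) : Ck_on k.+1 U f -> Ck_on k U f.
Proof.
elim: k f => [|k IHk] f [df Df]; split=> // v.
by apply: IHk; exact: Df.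
Qed.

(** The last entry of the list is the innermost derivative, the first one taken; peeling it off with
    [rcons] matches the recursion of [Ck_on]. *)
Lemma smooth_onP (R : realType) (V W : normedModType R) (U : set V)
    (f : V -> W) : smooth_on U f <-> forall k, Ck_on k U f.
Proof.
split=> [sf k|Cf vs].
  elim: k f sf => [|k IHk] f sf; (split; first by move=> x; exact: (sf [::])).
    by [].
  move=> v; apply: IHk => vs x Ux.
  by have := sf (rcons vs v) x Ux; rewrite foldr_rcons.
elim/last_ind: vs f Cf => [|vs v IHvs] f Cf x Ux.
  exact: Ck_on_differentiable (Cf 0) Ux.
rewrite foldr_rcons; apply: IHvs => // k.
by have [_] := Cf k.+1; exact.
Qed.

Lemma smooth_on_differentiable (R : realType) (V W : normedModType R)
    (U : set V) (f : V -> W) (x : V) :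
  smooth_on U f -> U x -> differentiable f x.
Proof. by move=> sf; exact: (sf [::]). Qed.

Lemma smooth_on_derive (R : realType) (V W : normedModType R)
    (U : set V) (f : V -> W) (v : V) : smooth_on U f -> smooth_on U ('D_v f).
Proof.
by move=> sf vs x Ux; have := sf (rcons vs v) x Ux; rewrite foldr_rcons.
Qed.

(** Since [U] is open, equality on [U] is equality near each of its points, so the derivatives agree
    on [U] as well. This allows a derivative to be replaced by a formula valid on [U] only. *)
Lemma eq_Ck_on (R : realType) (V W : normedModType R) (k : nat) (U : set V)
    (f g : V -> W) :
  open U -> (forall x, U x -> f x = g x) -> Ck_on k U f -> Ck_on k U g.
Proof.
move=> oU; elim: k f g => [|k IHk] f g fg [df Df].
  split=> // x Ux; apply: near_eq_differentiable (df x Ux).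
  by apply: filterS (open_nbhs_nbhs (conj oU Ux)).
split=> [x Ux|v].
  apply: near_eq_differentiable (df x Ux).
  by apply: filterS (open_nbhs_nbhs (conj oU Ux)).
apply: IHk (Df v) => x Ux; apply: near_eq_derive.
by apply: filterS (open_nbhs_nbhs (conj oU Ux)).
Qed.

Lemma Ck_onD (R : realType) (V W : normedModType R) (k : nat) (U : set V)
    (f g : V -> W) :
  open U -> Ck_on k U f -> Ck_on k U g -> Ck_on k U (fun x => f x + g x).
Proof.
move=> oU; elim: k f g => [|k IHk] f g [df Df] [dg Dg].
  by split=> // x Ux; apply: differentiableD; [exact: df|exact: dg].
split=> [x Ux|v]; first by apply: differentiableD; [exact: df|exact: dg].
apply: (eq_Ck_on oU _ (IHk _ _ (Df v) (Dg v))) => x Ux.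
by rewrite deriveD//; apply: diff_derivable; [exact: df|exact: dg].
Qed.

Lemma Ck_on_lin (R : realType) (V W Z : normedModType R) (k : nat) (U : set V)
    (L : {linear W -> Z}) (f : V -> W) :
  open U -> continuous L -> Ck_on k U f -> Ck_on k U (fun x => L (f x)).
Proof.
move=> oU cL; elim: k f => [|k IHk] f [df Df].
  by split=> // x Ux; case: (derive_lin 0 cL (df x Ux)).
split=> [x Ux|v]; first by case: (derive_lin 0 cL (df x Ux)).
apply: (eq_Ck_on oU _ (IHk _ (Df v))) => x Ux.
by case: (derive_lin v cL (df x Ux)).
Qed.

(** By the Leibniz rule the derivative is a sum of two terms of the same shape; the factor left
    undifferentiated is weakened by one order. *)
Lemma Ck_on_bilin (R : realType) (V W1 W2 Z : normedModType R) (k : nat)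
    (U : set V) (b : {bilinear W1 -> W2 -> Z}) (f : V -> W1) (g : V -> W2) :
  open U -> continuous (fun p => b p.1 p.2) ->
  Ck_on k U f -> Ck_on k U g -> Ck_on k U (fun x => b (f x) (g x)).
Proof.
move=> oU cb; elim: k f g => [|k IHk] f g Cf Cg.
  have [df _] := Cf; have [dg _] := Cg.
  by split=> // x Ux; case: (derive_bilin 0 cb (df x Ux) (dg x Ux)).
have [df Df] := Cf; have [dg Dg] := Cg.
split=> [x Ux|v]; first by case: (derive_bilin 0 cb (df x Ux) (dg x Ux)).
have C1 := IHk _ _ (Df v) (Ck_onW Cg).
have C2 := IHk _ _ (Ck_onW Cf) (Dg v).
apply: (eq_Ck_on oU _ (Ck_onD oU C1 C2)) => x Ux.
by case: (derive_bilin v cb (df x Ux) (dg x Ux)).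
Qed.

(** The derivative is minus the square of [f^-1] times ['D_v f], and [f^-1] has order [k] by
    induction. *)
Lemma Ck_on_inv (R : realType) (V : normedModType R) (k : nat) (U : set V)
    (f : V -> R) :
  open U -> (forall x, U x -> f x != 0) -> Ck_on k U f ->
  Ck_on k U (fun x => (f x)^-1).
Proof.
move=> oU f0; elim: k f f0 => [|k IHk] f f0 Cf.
  have [df _] := Cf.
  by split=> // x Ux; apply: differentiableV; [exact: df|exact: f0].
have [df Df] := Cf.
split=> [x Ux|v]; first by apply: differentiableV; [exact: df|exact: f0].
have mulc : continuous (fun p : R * R => p.1 * p.2) by exact: mul_continuous.
have C1 := IHk _ f0 (Ck_onW Cf).
have C2 := Ck_on_bilin (b := @GRing.mul R) oU mulc C1 C1.
have C3 := Ck_on_bilin (b := @GRing.mul R) oU mulc C2 (Df v).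
have negc : continuous (-%R : R -> R) by move=> x; exact: opp_continuous.
have C4 := Ck_on_lin (L := -%R) oU negc C3.
apply: (eq_Ck_on oU _ C4) => x Ux.
rewrite deriveV//=; [|exact: f0|by apply: diff_derivable; exact: df].
by rewrite -expr2 exprVn /GRing.scale/= mulNr.
Qed.

(** * Closure properties of smooth maps *)

Lemma smooth_onD (R : realType) (V W : normedModType R) (U : set V)
    (f g : V -> W) :
  open U -> smooth_on U f -> smooth_on U g -> smooth_on U (fun x => f x + g x).
Proof.
move=> oU /smooth_onP Cf /smooth_onP Cg; apply/smooth_onP => k.
exact: Ck_onD.
Qed.

Lemma smooth_on_lin (R : realType) (V W Z : normedModType R) (U : set V)
    (L : {linear W -> Z}) (f : V -> W) :
  open U -> continuous L -> smooth_on U f -> smooth_on U (fun x => L (f x)).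
Proof.
by move=> oU cL /smooth_onP Cf; apply/smooth_onP => k; exact: Ck_on_lin.
Qed.

Lemma smooth_on_mulmx (R : realType) (V : normedModType R) (U : set V)
    (m n p : nat) (f : V -> 'M[R]_(m, n)) (g : V -> 'M[R]_(n, p)) :
  open U -> smooth_on U f -> smooth_on U g ->
  smooth_on U (fun x => f x *m g x).
Proof.
move=> oU /smooth_onP Cf /smooth_onP Cg; apply/smooth_onP => k.
apply: (@Ck_on_bilin _ _ _ _ _ _ _ (@mulmx R m n p)) => //.
exact: mulmx_continuous.
Qed.

Lemma smooth_on_inv (R : realType) (V : normedModType R) (U : set V)
    (f : V -> R) :
  open U -> (forall x, U x -> f x != 0) -> smooth_on U f ->
  smooth_on U (fun x => (f x)^-1).
Proof.
by move=> oU f0 /smooth_onP Cf; apply/smooth_onP => k; exact: Ck_on_inv.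
Qed.

Lemma smooth_on_cst (R : realType) (V W : normedModType R) (U : set V)
    (a : W) : smooth_on U (fun _ : V => a).
Proof.
apply/smooth_onP => k; elim: k a => [|k IHk] a; split=> // v.
rewrite (_ : 'D_v _ = fun=> 0); first exact: IHk.
by apply/funext => x; rewrite derive_cst.
Qed.

Lemma smooth_on_id (R : realType) (V : normedModType R) (U : set V) :
  smooth_on U (@idfun V).
Proof.
apply/smooth_onP => -[|k]; split=> // v.
rewrite (_ : 'D_v _ = fun=> v).
  by have /smooth_onP := @smooth_on_cst R V V U v; exact.
by apply/funext => x; rewrite derive_id.
Qed.

(** The derivative of [f \o L] along [v] is the derivative of [f] along [L v], composed with [L];
    hence the induction runs over all [f]. *)
Lemma smooth_on_comp_lin (R : realType) (V W Z : normedModType R)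
    (f : W -> Z) (L : {linear V -> W}) :
  continuous L -> smooth_on setT f -> smooth_on setT (f \o L).
Proof.
move=> cL /smooth_onP Cf; apply/smooth_onP => k.
have dfL (g : W -> Z) x : differentiable g (L x) -> differentiable (g \o L) x.
  by move=> dg; apply: differentiable_comp => //; exact: linear_differentiable.
elim: k f Cf => [|k IHk] f Cf.
  by split=> // x _; apply: dfL; exact: Ck_on_differentiable (Cf 0) _.
split=> [x _|v]; first by apply: dfL; exact: Ck_on_differentiable (Cf 0) _.
rewrite (_ : 'D_v _ = 'D_(L v) f \o L).
  by apply: IHk => j; have [_] := Cf j.+1; exact.
apply/funext => x /=.
have df : differentiable f (L x) by exact: Ck_on_differentiable (Cf 0) _.
have dL : differentiable L x by exact: linear_differentiable.
rewrite deriveE; last exact: dfL.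
by rewrite deriveE// (diff_comp dL df) diff_lin.
Qed.

(** * Inner product and local geometry *)

Lemma dotC (R : realType) (k l : nat) (A B : 'M[R]_(k, l)) : dot A B = dot B A.
Proof. by rewrite /dot -mxtrace_tr trmx_mul trmxK. Qed.

Lemma dotDl (R : realType) (k l : nat) (A B C : 'M[R]_(k, l)) :
  dot (A + B) C = dot A C + dot B C.
Proof. by rewrite /dot mulmxDl linearD. Qed.

Lemma dotZl (R : realType) (k l : nat) (a : R) (A B : 'M[R]_(k, l)) :
  dot (a *: A) B = a * dot A B.
Proof. by rewrite /dot -scalemxAl linearZ. Qed.

Lemma dotBl (R : realType) (k l : nat) (A B C : 'M[R]_(k, l)) :
  dot (A - B) C = dot A C - dot B C.
Proof. by rewrite -scaleN1r dotDl dotZl mulN1r. Qed.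

Lemma dotDr (R : realType) (k l : nat) (A B C : 'M[R]_(k, l)) :
  dot A (B + C) = dot A B + dot A C.
Proof. by rewrite dotC dotDl -!(dotC A). Qed.

Lemma dotBr (R : realType) (k l : nat) (A B C : 'M[R]_(k, l)) :
  dot A (B - C) = dot A B - dot A C.
Proof. by rewrite dotC dotBl -!(dotC A). Qed.

Lemma dotZr (R : realType) (k l : nat) (a : R) (A B : 'M[R]_(k, l)) :
  dot A (a *: B) = a * dot A B.
Proof. by rewrite dotC dotZl dotC. Qed.

Lemma dot0l (R : realType) (k l : nat) (A : 'M[R]_(k, l)) : dot 0 A = 0.
Proof. by rewrite -(scale0r A) dotZl mul0r. Qed.

Lemma dotxxE (R : realType) (k l : nat) (A : 'M[R]_(k, l)) :
  dot A A = \sum_i \sum_j A i j ^+ 2.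
Proof.
apply: eq_bigr => i _; rewrite mxE; apply: eq_bigr => j _.
by rewrite mxE expr2.
Qed.

Lemma dotxx_ge0 (R : realType) (k l : nat) (A : 'M[R]_(k, l)) : 0 <= dot A A.
Proof.
rewrite dotxxE; apply: sumr_ge0 => i _; apply: sumr_ge0 => j _.
exact: sqr_ge0.
Qed.

Lemma dotxx_eq0 (R : realType) (k l : nat) (A : 'M[R]_(k, l)) :
  dot A A = 0 -> A = 0.
Proof.
rewrite dotxxE => A0; apply/matrixP => i j; rewrite mxE; apply/eqP.
have sq0 i' : true -> 0 <= \sum_j A i' j ^+ 2.
  by move=> _; apply: sumr_ge0 => j' _; exact: sqr_ge0.
have Ai0 := psumr_eq0P sq0 A0 (i := i) isT.
have := psumr_eq0P (fun j' _ => sqr_ge0 (A i j')) Ai0 (i := j) isT.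
by move/eqP; rewrite sqrf_eq0.
Qed.

Lemma dot_mulmxl (R : realType) (k k' l : nat) (M : 'M[R]_(k, k'))
    (A : 'M[R]_(k', l)) (B : 'M[R]_(k, l)) :
  dot (M *m A) B = dot A (M^T *m B).
Proof. by rewrite /dot -mulmxA mxtrace_mulC trmx_mul trmxK mulmxA. Qed.

Lemma mul_tr_col (R : realType) (k : nat) (x y : 'cV[R]_k) :
  x^T *m y = (dot x y)%:M.
Proof.
by rewrite [LHS]mx11_scalar dotC /dot mxtrace_mulC /mxtrace big_ord1.
Qed.

Lemma mulmx_col_dot (R : realType) (k l : nat) (z : 'M[R]_(l, 1))
    (x y : 'cV[R]_k) :
  z *m x^T *m y = dot x y *: z.
Proof. by rewrite -mulmxA mul_tr_col mul_mx_scalar. Qed.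

(* E and N are complementary orthonormal systems, so (E N) is an orthogonal
   matrix, whose left inverse is also a right inverse. *)
Lemma orthonormal_resolution (R : realType) (k d j : nat) (E : 'M[R]_(k, d))
    (N : 'M[R]_(k, j)) :
  (d + j)%N = k -> E^T *m E = 1%:M -> N^T *m N = 1%:M -> E^T *m N = 0 ->
  E *m E^T + N *m N^T = 1%:M.
Proof.
move=> kE; case: k / kE E N => E N EE NN EN.
have NE : N^T *m E = 0 by rewrite -[LHS]trmxK trmx_mul trmxK EN trmx0.
have : (row_mx E N)^T *m row_mx E N = 1%:M.
  by rewrite tr_row_mx mul_col_row EE NN EN NE -scalar_mx_block.
by move/mulmx1C; rewrite tr_row_mx mul_row_col.
Qed.

Lemma scale_is_bilinear (R : realType) (W : normedModType R) :
  bilinear_for (GRing.Scale.Law.clone _ _ *:%R _)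
    (GRing.Scale.Law.clone _ _ *:%R _) ( *:%R : R -> W -> W).
Proof.
split=> [w|a] b x y /=; first by rewrite scalerDl -scalerA.
by rewrite scalerDr !scalerA mulrC.
Qed.

(** Packaged as a bilinear map so that the Leibniz rule covers a scalar function times a
    vector-valued one. *)
Definition scale_bilin (R : realType) (W : normedModType R) :
    {bilinear R -> W -> W} :=
  HB.pack ( *:%R : R -> W -> W)
    (bilinear_isBilinear.Build R R W W _ _ ( *:%R : R -> W -> W)
      (scale_is_bilinear W)).

Lemma mxtrace_is_linear (R : realType) (k : nat) :
  linear_for ( *:%R : R -> R -> R) (mxtrace : 'M[R]_k -> R).
Proof. by move=> a A B; rewrite linearP. Qed.

Definition mxtrace_lin (R : realType) (k : nat) : {linear 'M[R]_k -> R} :=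
  HB.pack (mxtrace : 'M[R]_k -> R)
    (GRing.isLinear.Build R 'M[R]_k R _ (mxtrace : 'M[R]_k -> R)
      (@mxtrace_is_linear R k)).

Lemma derive_dot (R : realType) (V : normedModType R) (k l : nat)
    (f g : V -> 'M[R]_(k, l)) (x v : V) :
  differentiable f x -> differentiable g x ->
  'D_v (fun y => dot (f y) (g y)) x
    = dot ('D_v f x) (g x) + dot (f x) ('D_v g x).
Proof.
move=> df dg.
have ctr : continuous (@trmx R k l) by exact: linear_mx_continuous.
have [dgT DgT] := derive_lin v ctr dg.
have cmul := @mulmx_continuous R k l k.
have [dm Dm] := derive_bilin v (b := @mulmx R k l k) cmul df dgT.
have ct : continuous (mxtrace_lin R k) by exact: linear_mx_continuous.
by have [_] := derive_lin v ct dm; rewrite Dm DgT linearD.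
Qed.

(** The device by which an equation of the manifold, or an orthogonality relation between fields on
    [U], becomes a relation between derivatives. *)
Lemma derive_dot_cst (R : realType) (V : normedModType R) (k l : nat)
    (U : set V) (f g : V -> 'M[R]_(k, l)) (a : R) (x v : V) :
  open U -> U x -> (forall y, U y -> dot (f y) (g y) = a) ->
  differentiable f x -> differentiable g x ->
  dot ('D_v f x) (g x) + dot (f x) ('D_v g x) = 0.
Proof.
move=> oU Ux fga df dg; rewrite -derive_dot//.
rewrite (near_eq_derive (g := fun=> a)) ?derive_cst//.
by apply: filterS (open_nbhs_nbhs (conj oU Ux)).
Qed.

Lemma col_sum_delta (R : realType) (n : nat) (v : 'cV[R]_n) :
  v = \sum_i v i 0 *: delta_mx i 0.
Proof.
by rewrite {1}[v]matrix_sum_delta; apply: eq_bigr => i _; rewrite big_ord1.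
Qed.

(** The point [w] enters both through the differential and through the field. Expanding [X w] in
    coordinates leaves products of coordinate functions with partial derivatives of [f]. *)
Lemma differentiable_diff_field (R : realType) (W : normedModType R) (n : nat)
    (U : set 'cV[R]_n) (f : 'cV[R]_n -> W) (X : 'cV[R]_n -> 'cV[R]_n)
    (u : 'cV[R]_n) :
  open U -> smooth_on U f -> smooth_on U X -> U u ->
  differentiable (fun w => 'd f w (X w)) u.
Proof.
move=> oU sf sX Uu.
apply: (near_eq_differentiable
  (f := \sum_(i < n) (fun w => X w i 0 *: 'D_(delta_mx i 0) f w))).
  apply: filterS (open_nbhs_nbhs (conj oU Uu)) => w Uw.
  rewrite fct_sumE {2}(col_sum_delta (X w)) linear_sum; apply: eq_bigr => i _.
  by rewrite linearZ deriveE//; exact: smooth_on_differentiable sf Uw.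
apply: differentiable_sum => i.
have cs : continuous (fun p : R * W => p.1 *: p.2) by exact: scale_continuous.
have dXi : differentiable (fun w => X w i 0) u.
  apply: (@differentiable_comp _ _ _ _ X (fun y : 'cV[R]_n => y i 0)).
    exact: smooth_on_differentiable sX Uu.
  exact: differentiable_coord.
have dD : differentiable ('D_(delta_mx i 0) f) u.
  exact: smooth_on_differentiable (smooth_on_derive _ sf) Uu.
by case: (derive_bilin 0 (b := scale_bilin W) cs dXi dD).
Qed.

(** The relative openness condition, applied to [U] itself, presents the image as a part of [X]. *)
Lemma parametrization_in (R : realType) (W : normedModType R) (n : nat)
    (X : set W) (U : set 'cV[R]_n) (phi : 'cV[R]_n -> W) (u : 'cV[R]_n) :
  parametrization X U phi -> U u -> X (phi u).
Proof.
move=> [oU _ _ _ oX] Uu; have [B _ XB] := oX _ oU (@subset_refl _ U).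
by have : (phi @` U) (phi u) by [exists u]; rewrite XB; case.
Qed.

(** Two candidates differ by a vector that is both tangent and normal, hence orthogonal to
    itself. *)
Lemma normal_part_eq (R : realType) (k l n : nat) (E : {vspace 'M[R]_(k, l)})
    (f : 'cV[R]_n -> 'M[R]_(k, l)) (u : 'cV[R]_n) (w b : 'M[R]_(k, l)) :
  Defs.normal_space E f u b -> tangent_space f u (w - b) ->
  normal_part E f u w = b.
Proof.
move=> Nb Tb; rewrite /normal_part; set b' := xget _ _.
have [Nb' Tb'] : [set c | Defs.normal_space E f u c /\
    tangent_space f u (w - c)] b' by apply: xgetPex; exists b.
apply/eqP; rewrite -subr_eq0; apply/eqP/dotxx_eq0.
have Td : tangent_space f u (b' - b).
  have [[v _ vE] [v' _ vE']] := (Tb, Tb').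
  exists (v - v') => //; rewrite linearB vE vE'.
  by rewrite opprB addrC addrA subrK.
have [[_ _ /(_ _ Td) e1] [_ _ /(_ _ Td) e2]] := (Nb, Nb').
by rewrite dotBl e1 e2 subrr.
Qed.

Lemma char_poly_scalar (R : realType) (m : nat) (a : R) :
  char_poly (a%:M : 'M[R]_m) = ('X - a%:P) ^+ m.
Proof.
rewrite /char_poly /char_poly_mx map_scalar_mx -raddfB.
exact: det_scalar.
Qed.

Lemma spectrum_scalar (R : realType) (m : nat) (a : R) :
  spectrum (a%:M : 'M[R]_m) (nseq m a).
Proof.
split; last by rewrite char_poly_scalar big_nseq iter_mulr_1.
by case: m => //= m; elim: m => //= m ->; rewrite lexx.
Qed.

Lemma mulmx_tr_dot (R : realType) (k m n : nat) (A : 'M[R]_(k, m))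
    (B : 'M[R]_(k, n)) i j : (A^T *m B) i j = dot (col i A) (col j B).
Proof.
have := congr1 (fun M : 'M[R]_1 => M 0 0) (mul_tr_col (col i A) (col j B)).
rewrite [RHS]mxE eqxx mulr1n => <-; rewrite !mxE.
by apply: eq_bigr => l _; rewrite !mxE.
Qed.

Lemma addrr_eq0 (R : realType) (a : R) : a + a = 0 -> a = 0.
Proof. by move/eqP; rewrite -mulr2n mulrn_eq0 => /eqP. Qed.

(** * The torus as an intersection of two quadrics *)

Section Quadric.
Variables (R : realType) (k n : nat) (Q : 'M[R]_k) (t : R).
Hypotheses (kE : (n + 2)%N = k) (QT : Q^T = Q)
  (QQ : Q *m Q = t *: Q + 1%:M) (trQ : \tr Q = t).
Variables (U : set 'cV[R]_n) (f : 'cV[R]_n -> 'cV[R]_k).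
Hypotheses (oU : open U) (sf : smooth_on U f)
  (ff : forall w, U w -> dot (f w) (f w) = 1)
  (fQf : forall w, U w -> dot (f w) (Q *m f w) = 0).
Variables (u : 'cV[R]_n) (e : 'I_n -> 'cV[R]_n -> 'cV[R]_n).
Hypotheses (Uu : U u) (frame : tangent_frame f U u e).

Let x := f u.
Let y := Q *m x.
(** The tangent frame as columns; together with [x] and [y] they form an orthonormal basis of the
    ambient space. *)
Let E : 'M[R]_(k, n) := \matrix_(i, j) ('d f u (e j u)) i 0.

Let Qy : Q *m y = t *: y + x.
Proof. by rewrite mulmxA QQ mulmxDl -scalemxAl mul1mx. Qed.

Let xx : dot x x = 1. Proof. exact: ff. Qed.

Let xy : dot x y = 0. Proof. exact: fQf. Qed.

(** By symmetry of [Q], [<Q x, Q x> = <x, Q^2 x> = t <x, Q x> + <x, x>]. *)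
Let yy : dot y y = 1.
Proof. by rewrite {1}/y dot_mulmxl QT Qy dotDr dotZr xy mulr0 add0r. Qed.

Let dotQ (v w : 'cV[R]_k) : dot v (Q *m w) = dot (Q *m v) w.
Proof. by rewrite dot_mulmxl QT. Qed.

Let df w : U w -> differentiable f w.
Proof. by move=> Uw; exact: smooth_on_differentiable sf Uw. Qed.

Let derive_Qmul (g : 'cV[R]_n -> 'cV[R]_k) w v : differentiable g w ->
  differentiable (fun w' => Q *m g w') w /\
  'D_v (fun w' => Q *m g w') w = Q *m 'D_v g w.
Proof.
move=> dg; apply: (derive_lin (L := mulmx Q)) => //.
exact: linear_mx_continuous.
Qed.

Let tangent_x w v : U w -> dot ('d f w v) (f w) = 0.
Proof.
move=> Uw; have := derive_dot_cst v oU Uw ff (df Uw) (df Uw).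
by rewrite deriveE ?(dotC (f w)); [exact: addrr_eq0|exact: df].
Qed.

(** Differentiating [<f, Q f> = 0] gives two terms, which are equal because [Q] is symmetric. *)
Let tangent_y w v : U w -> dot ('d f w v) (Q *m f w) = 0.
Proof.
move=> Uw; have [dQ DQ] := derive_Qmul v (df Uw).
have := derive_dot_cst v oU Uw fQf (df Uw) dQ.
rewrite DQ deriveE ?(dotQ (f w)) ?(dotC (Q *m f w)); last exact: df.
exact: addrr_eq0.
Qed.

Let colE j : col j E = 'd f u (e j u).
Proof. by apply/colP => i; rewrite !mxE. Qed.

Let EE : E^T *m E = 1%:M.
Proof.
have [_ [_ on _]] := frame.
by apply/matrixP => i j; rewrite mulmx_tr_dot !colE on mxE.
Qed.

Let Ex : E^T *m x = 0.
Proof.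
apply/matrixP => i j; rewrite mulmx_tr_dot colE mxE.
by rewrite (_ : col j x = x) ?tangent_x//; apply/colP => l; rewrite mxE ord1.
Qed.

Let Ey : E^T *m y = 0.
Proof.
apply/matrixP => i j; rewrite mulmx_tr_dot colE mxE.
by rewrite (_ : col j y = y) ?tangent_y//; apply/colP => l; rewrite mxE ord1.
Qed.

Let resolution : E *m E^T + (x *m x^T + y *m y^T) = 1%:M.
Proof.
rewrite -[x *m x^T + _]mul_row_col -[col_mx _ _]tr_row_mx.
apply: (orthonormal_resolution (kE : (n + (1 + 1))%N = k) EE);
  last by rewrite mul_mx_row Ex Ey row_mx0.
rewrite tr_row_mx mul_col_row !mul_tr_col xx yy xy dotC xy raddf0.
by rewrite -scalar_mx_block.
Qed.

(** By [resolution], a vector [w] orthogonal to [x] and [y] equals [E E^T w], so the entries of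
    [E^T w] are its coordinates in the frame. *)
Let tangentP w : tangent_space f u w <-> dot w x = 0 /\ dot w y = 0.
Proof.
split=> [[v _ <-]|[wx wy]]; first by rewrite tangent_x ?tangent_y.
exists (\sum_i (E^T *m w) i 0 *: e i u) => //.
rewrite linear_sum -[RHS]mul1mx -resolution 2!mulmxDl !mulmx_col_dot.
rewrite !(dotC _ w) wx wy !scale0r !addr0 -mulmxA.
apply/colP => l; rewrite summxE mxE; apply: eq_bigr => i _.
by rewrite linearZ !mxE mulrC.
Qed.

(** Differentiating [<Y, Q f> = 0] along [e i] moves the derivative from [Y] to [f] and yields the
    [y]-component of the derivative of [Y]. *)
Lemma quadric_second_fundamental_form i j :
  second_fundamental_form fullv f (e i) (e j) u
  = - dot (col i E) (Q *m col j E) *: y.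
Proof.
have [se _] := frame.
pose Y w := 'd f w (e j w).
have dY : differentiable Y u.
  exact: differentiable_diff_field oU sf (se j) Uu.
have Yy w : U w -> dot (Y w) (Q *m f w) = 0 by exact: tangent_y.
have [dQ DQ] := derive_Qmul (e i u) (df Uu).
have DYy : dot ('D_(e i u) Y u) y = - dot (col i E) (Q *m col j E).
  have := derive_dot_cst (e i u) oU Uu Yy dY dQ.
  rewrite DQ (deriveE _ (df Uu)) -!colE => /eqP; rewrite addr_eq0 => /eqP ->.
  by rewrite /Y -colE dotQ dotC.
(* With the coefficient written as [<D, y>], the tangent remainder is [D] minus its components along
   the orthonormal vectors [x] and [y]. *)
rewrite -DYy /second_fundamental_form /sphere_nabla -/x -/Y.
set D := 'D_(e i u) Y u.
have [ty tx] : (dot y y = 1) * (dot y x = 0) by rewrite (dotC y x).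
apply: normal_part_eq.
  split=> [||w /tangentP[_ wy]]; first exact: memvf.
    by rewrite dotZl tx mulr0.
  by rewrite dotZl (dotC y) wy mulr0.
apply/tangentP; split; rewrite !dotBl !dotZl.
  by rewrite xx tx !(mulr1, mulr0) !subr0 subrr.
by rewrite xy yy !(mulr1, mulr0) subr0 subrr.
Qed.

(** Up to sign, the matrix in the frame of the shape operator for the normal [y]. *)
Let h : 'M[R]_n := E^T *m Q *m E.

Let hE i j : dot (col i E) (Q *m col j E) = h i j.
Proof. by rewrite /h -mulmxA mulmx_tr_dot !matrix.colE !mulmxA. Qed.

Let EEE : E *m E^T = 1%:M - (x *m x^T + y *m y^T).
Proof. by rewrite -resolution addrK. Qed.

Let hcomp : Q *m (E *m E^T) = Q - y *m x^T - (t *: y + x) *m y^T.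
Proof.
rewrite EEE mulmxBr mulmx1 mulmxDr (mulmxA Q x) (mulmxA Q y) Qy.
by rewrite opprD addrA.
Qed.

(** The trace is that of [Q E E^T], namely [t - <x, y> - <t y + x, y> = t - 0 - t]. *)
Let trh : \tr h = 0.
Proof.
rewrite /h -mulmxA mxtrace_mulC -mulmxA hcomp !linearB /= trQ.
rewrite -!/(dot _ _) dotC xy subr0 dotDl dotZl yy xy.
by rewrite mulr1 addr0 subrr.
Qed.

(** The trace of [h^2] is that of [A^2] for [A = Q E E^T]. As [A] kills [x] and [y], [A^2 = A Q],
    whose trace is [(t^2 + k) - 1 - (t^2 + 1) = k - 2]. *)
Let trhh : \tr (h *m h^T) = n%:R.
Proof.
have -> : h^T = h by rewrite /h !trmx_mul trmxK QT mulmxA.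
pose A := Q *m (E *m E^T).
have -> : \tr (h *m h) = \tr (A *m A).
  have -> : h *m h = E^T *m (Q *m E *m h) by rewrite /h !mulmxA.
  by rewrite mxtrace_mulC /A /h !mulmxA.
have [Ax Ay] : A *m x = 0 /\ A *m y = 0.
  rewrite /A hcomp !mulmxBl !mulmx_col_dot Qy xx xy dotC xy yy.
  by rewrite !scale1r !scale0r !subr0 !subrr.
have -> : A *m A = A *m Q.
  rewrite {2}/A hcomp !mulmxBr (mulmxA A y) (mulmxA A (_ + _)) Ay mulmxDr.
  by rewrite -scalemxAr Ax Ay scaler0 addr0 !mul0mx !subr0.
have QxT (v : 'cV[R]_k) : v^T *m Q = (Q *m v)^T by rewrite trmx_mul QT.
rewrite /A hcomp !mulmxBl -(mulmxA y) -(mulmxA (_ + _)) !QxT Qy QQ.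
rewrite !linearB /= linearD linearZ /=.
rewrite trQ mxtrace1 -!/(dot _ _) -/y yy dotDl !dotDr !dotZl !dotZr.
by rewrite (dotC y x) xx xy yy -kE natrD; ring.
Qed.

Lemma quadric_minimal :
  \sum_i second_fundamental_form fullv f (e i) (e i) u = 0.
Proof.
under eq_bigr do rewrite quadric_second_fundamental_form hE.
by rewrite -scaler_suml sumrN -/(mxtrace h) trh oppr0 scale0r.
Qed.

Lemma quadric_fundamental_matrix (nu : 'I_1 -> 'cV[R]_k) :
  orthonormal_basis (Defs.normal_space fullv f u) nu ->
  fundamental_matrix fullv f u e nu = n%:R%:M.
Proof.
move=> [Nnu onu _]; have [_ nux nuT] := Nnu 0.
(* In the resolution of the identity, [nu 0] has no component along the frame or along [x]; being a
   unit vector it is [y] up to sign, and the sign disappears in the square. *)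
have nuy : dot y (nu 0) ^+ 2 = 1.
  have := onu 0 0; rewrite -{1}[nu 0]mul1mx -resolution !mulmxDl !mulmx_col_dot.
  rewrite -mulmxA.
  have -> : E^T *m nu 0 = 0.
    apply/matrixP => i j; rewrite mulmx_tr_dot colE mxE dotC.
    rewrite (_ : col j (nu 0) = nu 0) ?nuT//; first by exists (e i u).
    by apply/colP => l; rewrite mxE ord1.
  by rewrite mulmx0 add0r (dotC x) nux scale0r add0r dotZl.
rewrite [LHS]mx11_scalar mxE; congr (_%:M).
rewrite -trhh; apply: eq_bigr => i _; rewrite mxE; apply: eq_bigr => j _.
rewrite quadric_second_fundamental_form hE dotZl mulrACA -!expr2 nuy.
rewrite mulr1 sqrrN.
by rewrite [h^T _ _]mxE expr2.
Qed.

End Quadric.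

(** * The Veronese immersion *)

Definition sym_outer (R : realType) (k : nat) (x y : 'cV[R]_k) : 'M[R]_k :=
  x *m y^T + y *m x^T.

Lemma sym_outer_tr (R : realType) (k : nat) (x y : 'cV[R]_k) :
  (sym_outer x y)^T = sym_outer x y.
Proof. by rewrite /sym_outer linearD /= !trmx_mul !trmxK addrC. Qed.

Lemma sym_outer_mul (R : realType) (k : nat) (x y z : 'cV[R]_k) :
  sym_outer x y *m z = dot y z *: x + dot x z *: y.
Proof. by rewrite mulmxDl !mulmx_col_dot. Qed.

Lemma dot_outer (R : realType) (k : nat) (x y : 'cV[R]_k) (M : 'M[R]_k) :
  dot (x *m y^T) M = dot x (M *m y).
Proof. by rewrite /dot -mulmxA -trmx_mul. Qed.

Lemma dot_sym_outer (R : realType) (k : nat) (x y : 'cV[R]_k) (M : 'M[R]_k) :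
  M^T = M -> dot (sym_outer x y) M = 2 * dot x (M *m y).
Proof.
move=> MT; rewrite dotDl !dot_outer (dotC y) dot_mulmxl MT.
by rewrite -mulr2n mulr_natl.
Qed.

Lemma dot_scalar (R : realType) (k : nat) (a : R) (M : 'M[R]_k) :
  dot a%:M M = a * \tr M.
Proof. by rewrite /dot mul_scalar_mx linearZ /= mxtrace_tr. Qed.

Lemma derive_outer (R : realType) (V : normedModType R) (k : nat)
    (f g : V -> 'cV[R]_k) (x v : V) :
  differentiable f x -> differentiable g x ->
  differentiable (fun y => f y *m (g y)^T) x /\
  'D_v (fun y => f y *m (g y)^T) x
    = 'D_v f x *m (g x)^T + f x *m ('D_v g x)^T.
Proof.
move=> df dg.
have ctr : continuous (@trmx R k 1) by exact: linear_mx_continuous.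
have [dgT <-] := derive_lin v ctr dg.
have cmul := @mulmx_continuous R k 1 k.
exact: (derive_bilin v (b := @mulmx R k 1 k) cmul df dgT).
Qed.

Lemma derive_sym_outer (R : realType) (V : normedModType R) (k : nat)
    (f g : V -> 'cV[R]_k) (x v : V) :
  differentiable f x -> differentiable g x ->
  differentiable (fun y => sym_outer (f y) (g y)) x /\
  'D_v (fun y => sym_outer (f y) (g y)) x
    = sym_outer ('D_v f x) (g x) + sym_outer (f x) ('D_v g x).
Proof.
move=> df dg; have [d1 D1] := derive_outer v df dg.
have [d2 D2] := derive_outer v dg df; split; first exact: differentiableD.
rewrite (deriveD (f := fun y => f y *m (g y)^T)); try exact: diff_derivable.
by rewrite D1 D2 /sym_outer [X in _ + X = _]addrC addrACA.
Qed.

Definition veronese_scale (R : realType) (n : nat) : R :=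
  2^-1 * Num.sqrt (n%:R / n.+1%:R).

Lemma veronese_scale_sqr (R : realType) (n : nat) :
  4 * veronese_scale R n ^+ 2 = n%:R / n.+1%:R.
Proof.
rewrite exprMn sqr_sqrtr ?divr_ge0// exprVn mulrA -natrX mulfV ?mul1r//.
Qed.

Section Veronese.
Variables (R : realType) (n : nat).
Hypothesis n_gt0 : (0 < n)%N.

Let r2 : R := (2 * n.+1)%:R / n%:R.
Let c : R := veronese_scale R n.
Let F := veronese R n.

Let n0 : n%:R != 0 :> R. Proof. by rewrite pnatr_eq0 -lt0n. Qed.

Let n1 : n.+1%:R != 0 :> R. Proof. by rewrite pnatr_eq0. Qed.

Let cc : c ^+ 2 = 4^-1 * (n%:R / n.+1%:R).
Proof. by rewrite -veronese_scale_sqr mulKf// pnatr_eq0. Qed.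

(** The normalization behind both the unit norm of the image and the isometry: the differential
    multiplies squared lengths by [2 c^2 r2]. *)
Let ccr2 : c ^+ 2 * (2 * r2) = 1.
Proof.
by rewrite cc /r2 natrM; field; rewrite n0 nat1r n1.
Qed.

Let c0 : c != 0.
Proof.
apply/eqP => c0; have /eqP := ccr2.
by rewrite c0 expr0n mul0r eq_sym oner_eq0.
Qed.

Let r20 : r2 != 0.
Proof.
apply/eqP => r20; have /eqP := ccr2.
by rewrite r20 !mulr0 eq_sym oner_eq0.
Qed.

Lemma veronese_mul (x : 'cV[R]_n.+1) z :
  F x *m z = c *: (dot x z *: x - (2 / n%:R) *: z).
Proof. by rewrite -scalemxAl mulmxBl mulmx_col_dot mul_scalar_mx. Qed.

Lemma veronese_tr (x : 'cV[R]_n.+1) : (F x)^T = F x.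
Proof. by rewrite linearZ linearB /= trmx_mul trmxK tr_scalar_mx. Qed.

Lemma veronese_mxtrace (x : 'cV[R]_n.+1) : dot x x = r2 -> \tr (F x) = 0.
Proof.
move=> xx; rewrite linearZ linearB /= -/(dot _ _) xx mxtrace_scalar /r2.
by rewrite natrM -[2 / _ *+ _]mulr_natr [X in X - _]mulrAC subrr mulr0.
Qed.

(** As [F x] is traceless, only [c <x, F x>] remains; it equals [c^2 (r2 - 2 / n) r2], and
    [r2 - 2 / n = 2]. *)
Lemma veronese_norm (x : 'cV[R]_n.+1) : dot x x = r2 -> dot (F x) (F x) = 1.
Proof.
move=> xx; rewrite {1}/F /veronese dotZl dotBl dot_scalar veronese_mxtrace//.
rewrite mulr0 subr0 dot_outer veronese_mul xx -scalerBl scalerA dotZr xx.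
rewrite -[RHS]ccr2 -[2^-1 * _]/c /r2 natrM.
by field; rewrite n0.
Qed.

Variables (U : set 'cV[R]_n) (phi : 'cV[R]_n -> 'cV[R]_n.+1).
Hypotheses (oU : open U) (sphi : smooth_on U phi)
  (pp : forall w, U w -> dot (phi w) (phi w) = r2).

Let dphi w : U w -> differentiable phi w.
Proof. by move=> Uw; exact: smooth_on_differentiable sphi Uw. Qed.

Lemma smooth_on_veronese : smooth_on U (F \o phi).
Proof.
have ctr : continuous (@trmx R n.+1 1) by exact: linear_mx_continuous.
have csc : continuous ( *:%R c : 'M[R]_n.+1 -> 'M[R]_n.+1).
  exact: linear_mx_continuous.
apply: (smooth_on_lin (L := *:%R c) oU csc).
apply: smooth_onD => //; last exact: smooth_on_cst.
by apply: smooth_on_mulmx => //; exact: smooth_on_lin.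
Qed.

Lemma diff_veronese w v : U w ->
  'd (F \o phi) w v = c *: sym_outer (phi w) ('d phi w v).
Proof.
move=> Uw; rewrite -!deriveE; last 2 first.
- exact: dphi.
- exact: smooth_on_differentiable smooth_on_veronese Uw.
have [d D] := derive_outer v (dphi Uw) (dphi Uw).
rewrite (_ : F \o phi =
  c \*: ((fun y => phi y *m (phi y)^T) - cst (2 / n%:R)%:M)).
  rewrite deriveZ; last by apply: diff_derivable; apply: differentiableB.
  by rewrite deriveB ?derive_cst ?subr0 ?D ?(addrC ('D_v phi w *m _))//;
    exact: diff_derivable.
by [].
Qed.

Lemma sphere_tangent w v : U w -> dot (phi w) ('d phi w v) = 0.
Proof.
move=> Uw; have := derive_dot_cst v oU Uw pp (dphi Uw) (dphi Uw).
by rewrite deriveE ?(dotC ('d _ _ _)); [exact: addrr_eq0|exact: dphi].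
Qed.

(** Orthogonality of tangent vectors to [phi w] removes the cross term, leaving the factor
    [2 c^2 r2]. *)
Lemma veronese_isometric w v v' : U w ->
  dot ('d (F \o phi) w v) ('d (F \o phi) w v') = dot ('d phi w v) ('d phi w v').
Proof.
move=> Uw; rewrite !diff_veronese// dotZl dotZr.
rewrite dot_sym_outer ?sym_outer_tr// sym_outer_mul.
rewrite (sphere_tangent _ Uw) scale0r addr0 dotZr pp//.
set d := dot _ _; transitivity (c ^+ 2 * (2 * r2) * d); first by ring.
by rewrite ccr2 mul1r /d dotC.
Qed.

Lemma veronese_immersive w : U w ->
  injective ('d phi w : 'cV[R]_n -> 'cV[R]_n.+1) ->
  injective ('d (F \o phi) w : 'cV[R]_n -> 'M[R]_n.+1).
Proof.
move=> Uw inj v v' vv'; apply: inj; apply/eqP; rewrite -subr_eq0 -linearB.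
apply/eqP/dotxx_eq0; rewrite -veronese_isometric// linearB.
by rewrite vv' subrr dot0l.
Qed.

(** * Second fundamental form of the Veronese immersion *)

Variables (u : 'cV[R]_n) (e : 'I_n -> 'cV[R]_n -> 'cV[R]_n).
Hypotheses (Uu : U u) (frame : tangent_frame (F \o phi) U u e).

Let x := phi u.
Let E : 'M[R]_(n.+1, n) := \matrix_(i, j) ('d phi u (e j u)) i 0.
(** This is [- 2 / n] times the orthogonal projection onto the complement of [x], since
    [(2 / n) / r2 = 1 / (n + 1)]. *)
Let K : 'M[R]_n.+1 := n.+1%:R^-1 *: (x *m x^T) - (2 / n%:R)%:M.

Let xx : dot x x = r2. Proof. exact: pp. Qed.

Let colEd j : col j E = 'd phi u (e j u).
Proof. by apply/colP => i; rewrite !mxE. Qed.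

Let col0 (w : 'cV[R]_n.+1) j : col j w = w.
Proof. by apply/colP => l; rewrite mxE ord1. Qed.

(** The given frame is orthonormal in the image; the isometry carries this back to the sphere. *)
Let EE : E^T *m E = 1%:M.
Proof.
have [_ [_ on _]] := frame.
apply/matrixP => i j.
by rewrite mulmx_tr_dot !colEd -veronese_isometric// on mxE.
Qed.

Let xE j : dot x (col j E) = 0.
Proof. by rewrite colEd sphere_tangent. Qed.

Let r2_gt0 : 0 < r2.
Proof. by rewrite lt_neqAle eq_sym r20 -xx dotxx_ge0. Qed.

Let resolution : E *m E^T + r2^-1 *: (x *m x^T) = 1%:M.
Proof.
(* The unit normal of the sphere at [x], which completes the frame. *)
pose N := (Num.sqrt r2)^-1 *: x.
have sr2 : (Num.sqrt r2)^-1 * (Num.sqrt r2)^-1 = r2^-1.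
  by rewrite -invfM -expr2 sqr_sqrtr// ltW.
have -> : r2^-1 *: (x *m x^T) = N *m N^T.
  by rewrite /N linearZ /= -scalemxAr -scalemxAl scalerA sr2.
apply: (orthonormal_resolution _ EE); first by rewrite addn1.
  by rewrite mul_tr_col /N dotZl dotZr mulrA sr2 xx mulVf.
apply/matrixP => i j; rewrite mulmx_tr_dot col0 mxE dotZr dotC.
by rewrite xE mulr0.
Qed.

Let sphere_tangentP w : dot x w = 0 -> exists v, 'd phi u v = w.
Proof.
move=> xw; exists (\sum_i (E^T *m w) i 0 *: e i u).
rewrite linear_sum -[RHS]mul1mx -resolution mulmxDl -scalemxAl mulmx_col_dot.
rewrite xw scale0r scaler0 addr0 -mulmxA.
apply/colP => l; rewrite summxE mxE; apply: eq_bigr => i _.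
by rewrite linearZ !mxE mulrC.
Qed.

Let r2n : n.+1%:R^-1 * r2 = 2 / n%:R.
Proof. by rewrite /r2 natrM; field; rewrite n0 nat1r n1. Qed.

Let Kx : K *m x = 0.
Proof.
rewrite mulmxBl -scalemxAl mulmx_col_dot xx mul_scalar_mx scalerA r2n.
by rewrite subrr.
Qed.

Let KT : K^T = K.
Proof. by rewrite linearB linearZ /= trmx_mul trmxK tr_scalar_mx. Qed.

Let trK : \tr K = - 2.
Proof.
rewrite linearB linearZ /= -/(dot _ _) xx r2n mxtrace_scalar.
by rewrite -[2 / _ *+ _]mulr_natr; field; rewrite n0.
Qed.

(** Both summands kill [x], and the trace [2 <v, w>] of the symmetrized product of [v] and [w] is
    cancelled by the trace [- 2] of [K]. *)
Let B i j : 'M[R]_n.+1 := c *: (sym_outer (col i E) (col j E) +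
  dot (col i E) (col j E) *: K).

Let Bx i j : B i j *m x = 0.
Proof.
rewrite -scalemxAl mulmxDl sym_outer_mul -scalemxAl Kx !(dotC _ x) !xE.
by rewrite !scale0r scaler0 !addr0 scaler0.
Qed.

Let BT i j : (B i j)^T = B i j.
Proof. by rewrite linearZ linearD linearZ /= sym_outer_tr KT. Qed.

Let trB i j : \tr (B i j) = 0.
Proof.
rewrite linearZ linearD linearZ /= trK linearD /= -!/(dot _ _).
by rewrite (dotC (col j E)); ring.
Qed.

Let tangentP w :
  tangent_space (F \o phi) u w <->
  exists2 z, dot x z = 0 & w = c *: sym_outer x z.
Proof.
split=> [[v _ <-]|[z xz ->]].
  by exists ('d phi u v); [exact: sphere_tangent|exact: diff_veronese].
have [v <-] := sphere_tangentP xz.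
by exists v => //; exact: diff_veronese.
Qed.

(** A symmetric matrix killing [x] is orthogonal to [x x^T] and to every symmetrized product of [x]
    with a vector; tracelessness handles the scalar part of [F x]. *)
Let normalB i j : Defs.normal_space (sym0 R n.+1) (F \o phi) u (B i j).
Proof.
split; first by apply/mem_sym0.
  rewrite dotC /= /F /veronese dotZl dotBl dot_scalar trB mulr0 subr0.
  by rewrite dot_outer Bx dotC dot0l mulr0.
move=> w /tangentP[z xz ->]; rewrite dotC dotZl dot_sym_outer//.
by rewrite -{1}BT -dot_mulmxl Bx dot0l !mulr0.
Qed.

Lemma veronese_second_fundamental_form i j :
  second_fundamental_form (sym0 R n.+1) (F \o phi) (e i) (e j) u = B i j.
Proof.
have [se _] := frame.
pose z w := 'd phi w (e j w).
have dz : differentiable z u.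
  exact: differentiable_diff_field oU sphi (se j) Uu.
have zu : z u = col j E by rewrite colEd.
pose Y w := 'd (F \o phi) w (e j w).
have dY : differentiable Y u.
  exact: differentiable_diff_field oU smooth_on_veronese (se j) Uu.
have dF := smooth_on_differentiable smooth_on_veronese Uu.
set v := e i u.
have Dphi : 'D_v phi u = col i E by rewrite deriveE ?colEd//; exact: dphi.
(* Differentiate [<Y, F> = 0]; the isometry turns the other term into an inner product of frame
   vectors on the sphere. *)
have DYf : dot ('D_v Y u) (F x) = - dot (col i E) (col j E).
  have Yf w : U w -> dot (Y w) ((F \o phi) w) = 0.
    move=> Uw; rewrite /Y diff_veronese// dotZl dot_sym_outer ?veronese_tr//.
    rewrite veronese_mul sphere_tangent// scale0r sub0r -scaleNr scalerA dotZr.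
    by rewrite sphere_tangent// !mulr0.
  have := derive_dot_cst v oU Uu Yf dY dF.
  rewrite (deriveE _ dF) veronese_isometric// -!colEd => /eqP.
  by rewrite addr_eq0 (dotC (col j E)) => /eqP.
have DY : 'D_v Y u =
    c *: (sym_outer (col i E) (col j E) + sym_outer x ('D_v z u)).
  have [d D] := derive_sym_outer v (dphi Uu) dz.
  rewrite (near_eq_derive (g := c \*: (fun w => sym_outer (phi w) (z w)))).
    by rewrite deriveZ ?D ?Dphi ?zu//; exact: diff_derivable.
  apply: filterS (open_nbhs_nbhs (conj oU Uu)) => w Uw.
  by rewrite /Y diff_veronese.
have xDz : dot x ('D_v z u) = - dot (col i E) (col j E).
  have phiz w : U w -> dot (phi w) (z w) = 0.
    by move=> Uw; exact: sphere_tangent.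
  have := derive_dot_cst v oU Uu phiz (dphi Uu) dz.
  by rewrite Dphi zu addrC => /eqP; rewrite addr_eq0 => /eqP.
rewrite /second_fundamental_form /sphere_nabla -/v -/Y.
rewrite [dot _ _]DYf DY; apply: normal_part_eq; first exact: normalB.
(* The witness is the projection of ['D_v z u] onto the complement of [x]: by [xDz] its component
   along [x] is [- <v, w> / r2] for the frame vectors [v] and [w]. *)
apply/tangentP; exists ('D_v z u + (r2^-1 * dot (col i E) (col j E)) *: x).
  by rewrite dotDr dotZr xx xDz mulrAC mulVf// mul1r addNr.
have -> : sym_outer x ('D_v z u + (r2^-1 * dot (col i E) (col j E)) *: x)
    = sym_outer x ('D_v z u)
      + ((1 - n.+1%:R^-1) * dot (col i E) (col j E)) *: (x *m x^T).
  (* The coefficient of [x x^T] is [1] from the position term of the sphere connection, minus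
     [1 / (n + 1)] from [K]; the correction of the witness contributes [2 / r2], the same number. *)
  have -> : 1 - n.+1%:R^-1 = r2^-1 + r2^-1 :> R.
    by rewrite /r2 natrM; field; rewrite n0 nat1r n1.
  rewrite /sym_outer linearD linearZ /= mulmxDr mulmxDl -scalemxAr -scalemxAl.
  by rewrite addrACA -scalerDl mulrDl.
rewrite /F /= /veronese -[2^-1 * _]/c /B /K -/x.
move: (sym_outer x _) (sym_outer _ _) (x *m x^T) (_%:M) (dot _ _) => T S X A d.
by apply/matrixP => a b; rewrite !mxE; ring.
Qed.

(** Up to [c] the sum is [2 E E^T + n K], and [K] is [- 2 / n] times the projection [E E^T]. *)
Lemma veronese_minimal :
  \sum_i second_fundamental_form (sym0 R n.+1) (F \o phi) (e i) (e i) u = 0.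
Proof.
under eq_bigr do rewrite veronese_second_fundamental_form.
rewrite -scaler_sumr big_split /= -scaler_suml.
have -> : \sum_i dot (col i E) (col i E) = n%:R.
  rewrite (eq_bigr (fun=> 1)) ?sumr_const ?card_ord// => i _.
  by rewrite -mulmx_tr_dot EE mxE eqxx.
have -> : \sum_i sym_outer (col i E) (col i E) = 2 *: (E *m E^T).
  rewrite scaler_nat mulr2n big_split /=.
  suff -> : \sum_i col i E *m (col i E)^T = E *m E^T by [].
  apply/matrixP => a b; rewrite summxE mxE; apply: eq_bigr => i _.
  by rewrite mxE big_ord1 !mxE.
rewrite -(addrK (r2^-1 *: (x *m x^T)) (E *m E^T)) resolution /K.
have -> : (2 / n%:R)%:M = (2 / n%:R) *: 1%:M :> 'M[R]_n.+1.
  by rewrite scale_scalar_mx mulr1.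
rewrite scalerBr scalerBr !scalerA mulrCA mulfV// mulr1.
have -> : n%:R * n.+1%:R^-1 = 2 * r2^-1.
  by rewrite /r2 natrM; field; rewrite n0 nat1r n1.
by rewrite addrC subrKA subrr scaler0.
Qed.

(** Orthogonality to [F x] and to the tangent space forces every normal matrix to kill [x], hence to
    be unchanged by multiplication with [E E^T]. The entries then reduce to [4 c^2 <nu a, nu b>]. *)
Lemma veronese_fundamental_matrix m (nu : 'I_m -> 'M[R]_n.+1) :
  orthonormal_basis (Defs.normal_space (sym0 R n.+1) (F \o phi) u) nu ->
  fundamental_matrix (sym0 R n.+1) (F \o phi) u e nu = (n%:R / n.+1%:R)%:M.
Proof.
move=> [Nnu onu _].
have nuT a : (nu a)^T = nu a by have [/mem_sym0[]] := Nnu a.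
have nutr a : \tr (nu a) = 0 by have [/mem_sym0[]] := Nnu a.
have xnux a : dot x (nu a *m x) = 0.
  have [_ + _] := Nnu a; rewrite dotC dotZl dotBl dot_scalar nutr mulr0 subr0.
  by rewrite dot_outer => /eqP; rewrite mulf_eq0 (negPf c0) => /eqP.
have Enux a j : dot (col j E) (nu a *m x) = 0.
  have [_ _] := Nnu a.
  move=> /(_ (c *: sym_outer x (col j E))) /= H.
  have /eqP : dot (nu a) (c *: sym_outer x (col j E)) = 0.
    by apply: H; apply/tangentP; exists (col j E).
  rewrite dotC dotZl dot_sym_outer// mulf_eq0 (negPf c0) mulf_eq0 pnatr_eq0.
  move=> /= /eqP.
  by rewrite dotC dot_mulmxl nuT.
have nux a : nu a *m x = 0.
  rewrite -[LHS]mul1mx -resolution mulmxDl -scalemxAl mulmx_col_dot xnux.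
  rewrite scale0r scaler0 addr0 -mulmxA (_ : E^T *m _ = 0) ?mulmx0//.
  by apply/matrixP => j l; rewrite mulmx_tr_dot col0 Enux mxE.
have nuE a : nu a *m (E *m E^T) = nu a.
  rewrite -{2}[nu a]mulmx1 -resolution mulmxDr -scalemxAr (mulmxA _ x) nux.
  by rewrite mul0mx scaler0 addr0.
(* The term in [K] drops out because [nu a] is traceless and [<x, nu a x> = 0]. *)
have Bnu i j a : dot (B i j) (nu a) = (2 * c) * (E^T *m nu a *m E) i j.
  rewrite dotZl dotDl dotZl dot_sym_outer// dotBl dotZl dot_outer xnux.
  rewrite dot_scalar nutr !(mulr0, subrr, addr0) -mulmxA mulmx_tr_dot.
  by rewrite !matrix.colE !mulmxA; ring.
apply/matrixP => a b; rewrite !mxE.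
transitivity (4 * c ^+ 2 * \tr ((E^T *m nu a *m E) *m (E^T *m nu b *m E)^T)).
  rewrite mulr_sumr; apply: eq_bigr => i _; rewrite mxE mulr_sumr.
  apply: eq_bigr => j _; rewrite !veronese_second_fundamental_form !Bnu.
  by rewrite [_^T _ _]mxE; ring.
rewrite veronese_scale_sqr !trmx_mul trmxK nuT -[RHS]mulr_natr -onu.
congr (_ * _).
have -> : E^T *m nu a *m E *m (E^T *m (nu b *m E))
    = E^T *m (nu a *m (E *m E^T) *m (nu b *m E)) by rewrite !mulmxA.
by rewrite nuE mxtrace_mulC -!mulmxA nuE /dot nuT.
Qed.

End Veronese.

(** * Stereographic charts *)

Lemma smooth_on_scale (R : realType) (V W : normedModType R) (U : set V)
    (a : V -> R) (f : V -> W) :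
  open U -> smooth_on U a -> smooth_on U f -> smooth_on U (fun x => a x *: f x).
Proof.
move=> oU /smooth_onP Ca /smooth_onP Cf; apply/smooth_onP => k.
have cs : continuous (fun p : R * W => p.1 *: p.2) by exact: scale_continuous.
exact: (Ck_on_bilin (b := scale_bilin W) oU cs).
Qed.

Lemma smooth_on_dot (R : realType) (V : normedModType R) (U : set V)
    (k l : nat) (f g : V -> 'M[R]_(k, l)) :
  open U -> smooth_on U f -> smooth_on U g ->
  smooth_on U (fun x => dot (f x) (g x)).
Proof.
move=> oU sf sg.
have ctr : continuous (@trmx R k l) by exact: linear_mx_continuous.
apply: (smooth_on_lin (L := mxtrace_lin R k)) => //.
  exact: linear_mx_continuous.
by apply: smooth_on_mulmx => //; exact: smooth_on_lin.
Qed.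

(** The inverse [g] is differentiable on an open set of the ambient space, so both immersivity and
    the homeomorphism property can be derived from [g \o phi = id]. *)
Definition chart (R : realType) (W : normedModType R) (n : nat) (X G : set W)
    (phi : 'cV[R]_n -> W) (g : W -> 'cV[R]_n) : Prop :=
  [/\ open G, smooth_on setT phi, forall x, G x -> differentiable g x,
      forall t, [/\ X (phi t), G (phi t) & g (phi t) = t] &
      forall x, X x -> G x -> phi (g x) = x].

(** The chain rule for [g \o phi = id] makes the differential of [phi] injective, and the image of
    an open [B] is cut out of [X] by the part of [G] that [g] sends into [B]. *)
Lemma chart_parametrization (R : realType) (W : normedModType R) (n : nat)
    (X G : set W) (phi : 'cV[R]_n -> W) (g : W -> 'cV[R]_n) :
  chart X G phi g -> parametrization X setT phi.
Proof.
move=> [oG sphi dg Xphi gK]; split=> //.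
- exact: openT.
- move=> u _ v v' vv'.
  have du : differentiable phi u by exact: smooth_on_differentiable sphi I.
  have [_ Gu _] := Xphi u.
  have gphi : g \o phi = idfun by apply/funext => t /=; case: (Xphi t).
  have := diff_comp du (dg _ Gu); rewrite gphi.
  rewrite (@diff_lin _ _ _ idfun) => [|x]; last exact: cvg_id.
  move=> H; have := congr1 (fun h => h v) H; rewrite /= vv'.
  by move=> ->; have := congr1 (fun h => h v') H; rewrite /= => <-.
- move=> t t' _ _ tt'; have [_ _ <-] := Xphi t; have [_ _ <-] := Xphi t'.
  by rewrite tt'.
move=> B oB _; exists (G `&` g @^-1` B).
  rewrite openE => x [Gx Bx]; apply: filterI; first exact: open_nbhs_nbhs.
  have cg : {for x, continuous g} by exact/differentiable_continuous/dg.
  by apply: cg; exact: open_nbhs_nbhs.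
apply/seteqP; split=> [_ [t Bt <-]|x [Xx [Gx Bx]]].
  by have [Xt Gt gt] := Xphi t; split=> //; split=> //=; rewrite gt.
by exists (g x) => //; exact: gK.
Qed.

Lemma chart_prod (R : realType) (k1 k2 n1 n2 : nat)
    (X1 G1 : set 'cV[R]_k1) (phi1 : 'cV[R]_n1 -> 'cV[R]_k1) g1
    (X2 G2 : set 'cV[R]_k2) (phi2 : 'cV[R]_n2 -> 'cV[R]_k2) g2 :
  chart X1 G1 phi1 g1 -> chart X2 G2 phi2 g2 ->
  chart [set col_mx x y | x in X1 & y in X2]
    (usubmx @^-1` G1 `&` dsubmx @^-1` G2)
    (fun t : 'cV[R]_(n1 + n2) => col_mx (phi1 (usubmx t)) (phi2 (dsubmx t)))
    (fun x : 'cV[R]_(k1 + k2) => col_mx (g1 (usubmx x)) (g2 (dsubmx x))).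
Proof.
move=> [oG1 s1 d1 X1phi g1K] [oG2 s2 d2 X2phi g2K].
have cu : continuous (@usubmx R k1 k2 1) by exact: linear_mx_continuous.
have cd : continuous (@dsubmx R k1 k2 1) by exact: linear_mx_continuous.
(* Stacking becomes a sum of products with constant matrices, to which the differentiation rules
   apply. *)
have colE (V : Type) m1 m2 (f1 : V -> 'cV[R]_m1) (f2 : V -> 'cV[R]_m2) :
    (fun x => col_mx (f1 x) (f2 x)) =
    (fun x => col_mx 1%:M 0 *m f1 x + col_mx 0 1%:M *m f2 x).
  apply/funext => x; rewrite !mul_col_mx !mul1mx !mul0mx add_col_mx.
  by rewrite addr0 add0r.
split.
- by apply: openI; apply: open_comp => // x _.
- rewrite colE; apply: smooth_onD; first exact: openT.
    apply: smooth_on_mulmx; [exact: openT|exact: smooth_on_cst|].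
    apply: (smooth_on_comp_lin (L := usubmx)) => //.
    exact: linear_mx_continuous.
  apply: smooth_on_mulmx; [exact: openT|exact: smooth_on_cst|].
  apply: (smooth_on_comp_lin (L := dsubmx)) => //.
  exact: linear_mx_continuous.
- move=> x [Gx1 Gx2]; rewrite colE; apply: differentiableD.
    have dx : differentiable (g1 \o usubmx) x.
      by apply: differentiable_comp; [exact: linear_differentiable|exact: d1].
    apply: (differentiable_comp dx).
    apply: (@linear_differentiable _ _ _ (mulmx _)).
    exact: linear_mx_continuous.
  have dx : differentiable (g2 \o dsubmx) x.
    by apply: differentiable_comp; [exact: linear_differentiable|exact: d2].
  apply: (differentiable_comp dx).
  apply: (@linear_differentiable _ _ _ (mulmx _)).
  exact: linear_mx_continuous.
- move=> t; have [X1t G1t g1t] := X1phi (usubmx t).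
  have [X2t G2t g2t] := X2phi (dsubmx t).
  split; first by exists (phi1 (usubmx t)) => //; exists (phi2 (dsubmx t)).
    by rewrite /= col_mxKu col_mxKd.
  by rewrite col_mxKu col_mxKd g1t g2t vsubmxK.
move=> _ [x X1x [y X2y <-]] /=; rewrite !col_mxKu !col_mxKd => -[G1x G2y].
by rewrite g1K ?g2K.
Qed.

(** The columns of [A] are a basis of the complement of [x0], obtained from the kernel of [x0]; a
    pseudo-inverse supplies the coordinates [B]. *)
Lemma orthogonal_coordinates (R : realType) (n : nat) (x0 : 'cV[R]_n.+1) :
  x0 != 0 -> exists (A : 'M[R]_(n.+1, n)) (B : 'M[R]_(n, n.+1)),
    [/\ B *m A = 1%:M, forall t : 'cV[R]_n, dot (A *m t) x0 = 0 &
      forall y : 'cV[R]_n.+1, dot y x0 = 0 -> A *m (B *m y) = y].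
Proof.
move=> x0_neq0.
have rk : \rank (kermx x0) = n.
  rewrite mxrank_ker -mxrank_tr rank_rV -(trmx0 _ _ _) (inj_eq trmx_inj).
  by rewrite x0_neq0 subn1.
pose M := castmx (rk, erefl) (row_base (kermx x0)).
have Mfree : row_free M by rewrite row_free_castmx row_base_free.
have MK : (M :=: kermx x0)%MS.
  by apply: eqmx_trans (eqmx_cast _ _) _; exact: eq_row_base.
exists M^T, (pinvmx M)^T; split.
- by rewrite -trmx_mul mulmxVp// trmx1.
- move=> t; rewrite dot_mulmxl trmxK.
  by rewrite (sub_kermxP _) ?MK// dotC dot0l.
- move=> y yx0; rewrite mulmxA -!trmx_mul -[y]trmxK -trmx_mul mulmxA mulmxKpV//.
  by rewrite MK; apply/sub_kermxP; rewrite mul_tr_col yx0 raddf0.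
Qed.

(* Stereographic projection of the sphere from the antipode of x0 to the
   hyperplane x0^perp. *)
Lemma sphere_chart (R : realType) (n : nat) (r2 : R) (x0 : 'cV[R]_n.+1) :
  0 < r2 -> dot x0 x0 = r2 -> exists G phi g,
    @chart R _ n [set x | dot x x = r2] G phi g /\ G x0.
Proof.
move=> r2_gt0 x0x0; have r2_neq0 : r2 != 0 by rewrite gt_eqF.
have x0_neq0 : x0 != 0.
  by apply: contra_neq r2_neq0 => x00; rewrite -x0x0 x00 dot0l.
have [A [B [BA Ax0 ABK]]] := orthogonal_coordinates x0_neq0.
(* The line from [- x0] through [A t] is [a (x0 + A t) - x0]; it meets the sphere again at
   [a = 2 r2 / q t]. *)
pose q (t : 'cV[R]_n) := r2 + dot (A *m t) (A *m t).
pose phi t := (2 * r2 * (q t)^-1) *: (x0 + A *m t) - x0.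
(* As [s x = <x + x0, x0>], the factor [r2 / s x] in [h] is the one placing the line from [- x0]
   through [x] in the hyperplane orthogonal to [x0]. *)
pose s (x : 'cV[R]_n.+1) := r2 + dot x x0.
pose h x := (r2 * (s x)^-1) *: (x + x0) - x0.
have q_neq0 t : q t != 0 by rewrite gt_eqF// ltr_pwDl// dotxx_ge0.
have norm_x0D (y : 'cV[R]_n.+1) : dot y x0 = 0 ->
    dot (x0 + y) (x0 + y) = r2 + dot y y.
  by move=> yx0; rewrite dotDl !dotDr x0x0 (dotC x0) yx0 addr0 add0r.
have sphi t : s (phi t) = 2 * r2 * (q t)^-1 * r2.
  by rewrite /s /phi dotBl dotZl dotDl x0x0 Ax0 addr0 subrKC.
have ss : smooth_on setT s.
  apply: smooth_onD; [exact: openT|exact: smooth_on_cst|].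
  apply: smooth_on_dot;
    [exact: openT|exact: smooth_on_id|exact: smooth_on_cst].
have oG : open [set x | s x != 0].
  rewrite (_ : mkset _ = s @^-1` ~` [set 0]); last first.
    by apply/seteqP; split=> x /eqP.
  apply: open_comp => [x _|]; last exact/closed_openC/closed_eq.
  apply: differentiable_continuous.
  exact: smooth_on_differentiable ss I.
exists [set x | s x != 0], phi, (fun x => B *m h x); split; last first.
  by rewrite /= /s x0x0 gt_eqF// addr_gt0.
split=> //.
- have oT := @openT 'cV[R]_n.
  have sA : smooth_on setT (fun t : 'cV[R]_n => A *m t).
    by apply: smooth_on_mulmx => //; [exact: smooth_on_cst|exact: smooth_on_id].
  apply: smooth_onD => //; last exact: smooth_on_cst.
  apply: smooth_on_scale => //; last first.
    by apply: smooth_onD => //; exact: smooth_on_cst.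
  apply: (smooth_on_scale (a := fun=> 2 * r2) (f := fun t => (q t)^-1)) => //.
    exact: smooth_on_cst.
  apply: smooth_on_inv => //.
  apply: smooth_onD => //; first exact: smooth_on_cst.
  exact: smooth_on_dot.
- move=> x Gx; apply: (@differentiable_comp _ _ _ _ h (mulmx B)).
    apply: (@smooth_on_differentiable _ _ _ [set x | s x != 0]) => //.
    apply: smooth_onD => //; last exact: smooth_on_cst.
    apply: smooth_on_scale => //.
      apply: (smooth_on_scale (a := fun=> r2) (f := fun t => (s t)^-1)) => //.
        exact: smooth_on_cst.
      by apply: smooth_on_inv => // vs y _; exact: ss.
    by apply: smooth_onD => //; [exact: smooth_on_id|exact: smooth_on_cst].
  by apply: linear_differentiable; exact: linear_mx_continuous.
- move=> t; split=> /=.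
  + rewrite /phi dotBl !dotBr !dotZl !dotZr norm_x0D// -/(q t) (dotC x0).
    by rewrite dotDl x0x0 Ax0; field; exact: q_neq0.
  + by rewrite sphi !mulf_neq0// ?invr_eq0// pnatr_eq0.
  + rewrite /h sphi /phi subrK scalerA.
    rewrite (_ : _ * _ = 1); last by field; rewrite r2_neq0 q_neq0.
    by rewrite scale1r addrC addKr mulmxA BA mul1mx.
move=> x /= xx sx.
have hx0 : dot (h x) x0 = 0.
  rewrite /h dotBl dotZl dotDl x0x0 addrC (addrC (dot x x0)) -/(s x).
  by rewrite -mulrA mulVf// mulr1 addNr.
(* On the sphere [x + x0] has squared norm [2 s x], so rescaling by [r2 / s x] gives this value and
   the two stereographic factors cancel. *)
have qh : q (B *m h x) = 2 * r2 ^+ 2 / s x.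
  rewrite /q ABK// -norm_x0D// /h subrKC dotZl dotZr dotDl !dotDr xx x0x0.
  rewrite (dotC x0).
  have -> : r2 + dot x x0 + (dot x x0 + r2) = 2 * s x by rewrite /s; ring.
  by field.
rewrite /phi ABK// qh /h subrKC scalerA.
rewrite (_ : _ * _ = 1); last by field; rewrite r2_neq0 sx.
by rewrite scale1r addrK.
Qed.

(** * Dimension of the space of traceless symmetric matrices *)

Lemma card_le_pairs (k : nat) :
  #|{: {ij : 'I_k * 'I_k | (ij.1 <= ij.2)%N}}| = 'C(k.+1, 2).
Proof.
rewrite card_sig -sum1_card.
rewrite -(pair_big_dep xpredT (fun i j : 'I_k => i <= j)%N (fun _ _ => 1%N)) /=.
(* Counting by the larger index [j] gives [j + 1] pairs; splitting off the zero term of the sum for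
   ['C(k.+1, 2)] shifts its indices to match. *)
rewrite (exchange_big_dep xpredT) //= -bin2_sum big_mkord big_ord_recl add0n.
apply: eq_bigr => j _.
rewrite -(big_ord_widen k (fun=> 1%N) (ltn_ord j)) sum1_card card_ord.
by rewrite /bump.
Qed.

(** Reading the entries with [i <= j] is an isomorphism from the symmetric matrices onto the vectors
    indexed by such pairs. *)
Lemma dim_sym (R : realType) (k : nat) :
  \dim (lker (linfun (idfun \- @trmx R k k))) = 'C(k.+1, 2).
Proof.
set S := lker _.
pose T := {: {ij : 'I_k * 'I_k | (ij.1 <= ij.2)%N}}.
pose f (A : 'M[R]_k) : 'rV[R]_#|T| :=
  \row_t A (val (enum_val t)).1 (val (enum_val t)).2.
have fl : linear f by move=> a A B; apply/rowP => t; rewrite !mxE.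
pose fL : {linear 'M[R]_k -> 'rV[R]_#|T|} :=
  HB.pack f (GRing.isLinear.Build _ _ _ _ f fl).
have memS A : (A \in S) = (A^T == A).
  by rewrite memv_ker lfunE /= subr_eq0 eq_sym.
have Sker : (S :&: lker (linfun fL) = 0)%VS.
  apply/eqP; rewrite -subv0; apply/subvP => A.
  rewrite memv_cap memS memv_ker lfunE /= memv0 => /andP[/eqP AT /eqP fA].
  have Aij (i j : 'I_k) : (i <= j)%N -> A i j = 0.
    move=> ij; pose t : T := exist _ (i, j) ij.
    have := congr1 (fun v : 'rV_ _ => v 0 (enum_rank t)) fA.
    by rewrite !mxE enum_rankK.
  apply/eqP/matrixP => i j; rewrite mxE.
  case: (leqP i j) => [|/ltnW] ij; first exact: Aij.
  by rewrite -AT mxE Aij.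
rewrite -(limg_dim_eq Sker) (_ : (_ @: S)%VS = fullv).
  by rewrite dimvf dim_matrix mul1r card_le_pairs.
apply/vspaceP => v; rewrite memvf.
(* The default [0] is never reached in [A], which sorts each index pair before applying [w]; the
   sorting also makes [A] symmetric. *)
pose w (ij : 'I_k * 'I_k) := oapp (fun t : T => v 0 (enum_rank t)) 0 (insub ij).
pose A := \matrix_(i, j) w (if (i <= j)%N then (i, j) else (j, i)).
have AS : A \in S.
  rewrite memS; apply/eqP/matrixP => i j; rewrite !mxE.
  by case: ltngtP => // ij; rewrite (val_inj ij).
have -> : v = linfun fL A.
  apply/rowP => t; rewrite lfunE /= !mxE (valP (enum_val t)).
  by rewrite -surjective_pairing /w valK /= enum_valK.
exact: memv_img.
Qed.

(** Rank-nullity for the trace on symmetric matrices: its image is a line, as the identity has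
    nonzero trace. *)
Lemma dim_sym0 (R : realType) (k : nat) :
  (\dim (sym0 R k.+1)).+1 = 'C(k.+2, 2).
Proof.
rewrite -(dim_sym R) /sym0; set S := lker (linfun (idfun \- _)).
set tr := linfun _; rewrite -(limg_ker_dim tr S) -addn1; congr (_ + _)%N.
apply/eqP; rewrite eq_sym eqn_leq; apply/andP; split.
  by apply: leq_trans (dimvS (subvf _)) _; rewrite dimvf.
rewrite lt0n dimv_eq0; apply/negP => /eqP tr0.
have : tr 1%:M \in (tr @: S)%VS.
  by apply: memv_img; rewrite memv_ker lfunE /= tr_scalar_mx subrr.
by rewrite tr0 memv0 lfunE /= mxtrace1 pnatr_eq0.
Qed.

(** * Generalized Clifford tori and Veronese manifolds *)

Lemma sphereE (R : realType) (q : nat) (a : R) :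
  0 <= a -> sphere q (Num.sqrt a) = [set x | dot x x = a].
Proof.
move=> a0; apply/seteqP; split=> x /= xa; last by rewrite /sphere /= xa.
by rewrite -[LHS]sqr_sqrtr ?dotxx_ge0// xa sqr_sqrtr.
Qed.

Lemma closed_dot_eq (R : realType) (k l m : nat)
    (f g : 'cV[R]_k -> 'M[R]_(l, m)) (a : R) :
  smooth_on setT f -> smooth_on setT g -> closed [set x | dot (f x) (g x) = a].
Proof.
move=> sf sg; apply: (@preimage_closed _ _ (fun x => dot (f x) (g x)) [set a]).
  move=> x _; apply: differentiable_continuous.
  exact: smooth_on_differentiable (smooth_on_dot (@openT _) sf sg) I.
exact: closed_eq.
Qed.

(** Heine-Borel is applied to row vectors and the result is carried over by the continuous
    transposition. *)
Lemma compact_dot_eq (R : realType) (k : nat) (a : R) :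
  compact [set x : 'cV[R]_k | dot x x = a].
Proof.
have ctr m n : continuous (@trmx R m n) by exact: linear_mx_continuous.
rewrite (_ : mkset _ = trmx @` [set v : 'rV[R]_k | dot v v = a]); last first.
  apply/seteqP; split=> [x /= <-|_ [v <- <-]].
    by exists x^T; rewrite ?trmxK// /dot trmxK mxtrace_mulC.
  by rewrite /= /dot trmxK mxtrace_mulC.
apply: continuous_compact; first exact/continuous_subspaceT/ctr.
apply: bounded_closed_compact.
  exists (a + 1); split=> [|M aM v /= va]; first exact: num_real.
  have M0 : 0 < M by apply: le_lt_trans aM; rewrite -va addr_ge0// dotxx_ge0.
  rewrite [leLHS]/Num.Def.normr/= mx_normrE; apply: bigmax_le; first exact: ltW.
  move=> [i j] _ /=; apply: ltW; apply: le_lt_trans aM; rewrite -va.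
  have vij : v i j ^+ 2 <= dot v v.
    rewrite dotxxE (bigD1 i)//= (bigD1 j)//= -addrA lerDl addr_ge0//.
      by apply: sumr_ge0 => j' _; exact: sqr_ge0.
    apply: sumr_ge0 => i' _; apply: sumr_ge0 => j' _; exact: sqr_ge0.
  (* The norm is the maximum of the entries, and [|r| <= r^2 + 1] bounds each of them by [a + 1]. *)
  apply: (@le_trans _ _ (v i j ^+ 2 + 1)); last by rewrite lerD2r.
  rewrite -(real_normK (num_real (v i j))) -subr_ge0.
  have -> : `|v i j| ^+ 2 + 1 - `|v i j| = (`|v i j| - 2^-1) ^+ 2 + 3 / 4.
    by field.
  by rewrite addr_ge0 ?sqr_ge0// divr_ge0.
rewrite (_ : mkset _ = trmx @^-1` [set x : 'cV[R]_k | dot x x = a]).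
  apply: preimage_closed => [v _|]; first exact: ctr.
  by apply: closed_dot_eq; exact: smooth_on_id.
by apply/seteqP; split=> v /=; rewrite /dot trmxK mxtrace_mulC.
Qed.

Lemma dot_col_mx (R : realType) (k1 k2 : nat) (a c : 'cV[R]_k1)
    (b d : 'cV[R]_k2) :
  dot (col_mx a b) (col_mx c d) = dot a c + dot b d.
Proof. by rewrite /dot tr_col_mx mul_col_row mxtrace_block. Qed.

(** * Generalized Clifford tori *)

Section CliffordTorus.
Variables (R : realType) (p q : nat).
Hypotheses (p_gt0 : (0 < p)%N) (q_gt0 : (0 < q)%N).

Let s : R := Num.sqrt (q%:R / p%:R).
Let t : R := s - s^-1.
Let Q : 'M[R]_(p.+1 + q.+1) := block_mx s%:M 0 0 (- s^-1)%:M.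

Let p0 : p%:R != 0 :> R. Proof. by rewrite pnatr_eq0 -lt0n. Qed.
Let pq0 : (p + q)%:R != 0 :> R.
Proof. by rewrite pnatr_eq0 -lt0n addn_gt0 p_gt0. Qed.

Let s0 : s != 0.
Proof. by rewrite gt_eqF// sqrtr_gt0 divr_gt0// ltr0n. Qed.

Let sp : s * p%:R = s^-1 * q%:R.
Proof.
apply: (mulfI s0); rewrite !mulrA -expr2 sqr_sqrtr ?divr_ge0// mulfV// mul1r.
by rewrite mulfVK.
Qed.

Let QT : Q^T = Q.
Proof. by rewrite tr_block_mx !tr_scalar_mx !trmx0. Qed.

(** The diagonal entries [s] and [- 1 / s] are the roots of [X^2 - t X - 1]. *)
Let QQ : Q *m Q = t *: Q + 1%:M.
Proof.
rewrite mulmx_block !mulmx0 !mul0mx !addr0 !add0r -!scalar_mxM.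
rewrite scale_block_mx !scaler0 !scale_scalar_mx scalar_mx_block add_block_mx.
rewrite !addr0 -!raddfD /=; congr (block_mx _%:M _ _ _%:M).
  by rewrite /t mulrBl mulVf// subrK.
by rewrite /t; field.
Qed.

(** The blocks have sizes [p + 1] and [q + 1]; by [sp] the parts in [p] and [q] cancel, leaving
    [s - 1 / s]. *)
Let trQ : \tr Q = t.
Proof.
rewrite mxtrace_block !mxtrace_scalar -[s *+ _]mulr_natr -[_ *+ q.+1]mulr_natr.
rewrite mulNr -!natr1 !mulrDr sp !mulr1 /t; ring.
Qed.

Let Qcol (a : 'cV[R]_p.+1) (b : 'cV[R]_q.+1) :
  Q *m col_mx a b = col_mx (s *: a) (- s^-1 *: b).
Proof.
by rewrite mul_block_col !mul0mx !mul_scalar_mx addr0 add0r.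
Qed.

(** For [x = (a, b)] the second equation says [q |a|^2 = p |b|^2]; with [|a|^2 + |b|^2 = 1] this
    determines both radii. *)
Lemma clifford_torusE :
  clifford_torus R p q = [set x | dot x x = 1 /\ dot x (Q *m x) = 0].
Proof.
rewrite /clifford_torus !sphereE ?divr_ge0//; apply/seteqP; split.
  move=> _ [a /= aE [b /= bE <-]]; rewrite Qcol !dot_col_mx !dotZr aE bE.
  split; first by rewrite -mulrDl -natrD mulfV.
  by rewrite mulNr !mulrA sp subrr.
move=> x /= []; rewrite -[x]vsubmxK Qcol !dot_col_mx !dotZr.
set a := usubmx x; set b := dsubmx x => ab1 ab0.
have aq_bp : dot a a * q%:R = dot b b * p%:R.
  move/eqP: ab0; rewrite mulNr subr_eq0 => /eqP ab0.
  apply: (mulfI s0); rewrite mulrA ab0 mulrAC -sp -mulrA.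
  by rewrite (mulrC p%:R).
have aE : dot a a = p%:R / (p + q)%:R.
  by apply: (canRL (mulfK pq0)); rewrite natrD mulrDr aq_bp -mulrDl ab1 mul1r.
exists a => //; exists b; last by rewrite vsubmxK.
apply: (canRL (mulfK pq0)); rewrite natrD mulrDr -aq_bp -mulrDl addrC.
by rewrite (addrC (dot b b)) ab1 mul1r.
Qed.

Let X := clifford_torus R p q.

Lemma clifford_torus_compact : compact X.
Proof.
rewrite /X clifford_torusE; apply: subclosed_compact (@compact_dot_eq R _ 1) _.
  apply: closedI; first by apply: closed_dot_eq; exact: smooth_on_id.
  apply: closed_dot_eq; first exact: smooth_on_id.
  apply: smooth_on_mulmx;
    [exact: openT|exact: smooth_on_cst|exact: smooth_on_id].
by move=> x [].
Qed.

Lemma clifford_torus_embedded : embedded_manifold (p + q) X.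
Proof.
move=> x; rewrite /X /clifford_torus => -[a + [b + <-]].
have pq_gt0 : 0 < (p + q)%:R :> R by rewrite lt_neqAle eq_sym pq0 ler0n.
rewrite !sphereE ?divr_ge0// => /= aE bE.
have [||G1 [phi1 [g1 [c1 G1a]]]] :=
  @sphere_chart R p (p%:R / (p + q)%:R) a => //.
  by rewrite divr_gt0// ltr0n.
have [||G2 [phi2 [g2 [c2 G2b]]]] :=
  @sphere_chart R q (q%:R / (p + q)%:R) b => //.
  by rewrite divr_gt0// ltr0n.
have c := chart_prod c1 c2; exists setT; eexists; split.
  exact: chart_parametrization c.
have [_ _ _ _ gK] := c.
eexists; last first.
  by apply: gK; [exists a => //; exists b|rewrite /= ?col_mxKu ?col_mxKd].
by [].
Qed.

Let n_gt0 : (0 < p + q)%N. Proof. by rewrite addn_gt0 p_gt0. Qed.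

Let kE : (p + q + 2)%N = (p.+1 + q.+1)%N.
Proof. by rewrite addn2 addSn addnS. Qed.

Lemma clifford_torus_minimal :
  minimal_submanifold (p + q) 1 {: 'cV[R]_(p.+1 + q.+1)}%VS X idfun.
Proof.
have XE (U : set 'cV[R]_(p + q)) phi w : parametrization X U phi -> U w ->
    dot (phi w) (phi w) = 1 /\ dot (phi w) (Q *m phi w) = 0.
  by move=> par /(parametrization_in par); rewrite /X clifford_torusE.
split; first split.
- by rewrite dimvf dim_matrix mulr1 addSn addnS addn1.
- exact: clifford_torus_embedded.
- by move=> x; rewrite /X clifford_torusE => -[xx _]; split; rewrite ?memvf.
- by move=> U phi [oU sphi inj _ _]; split.
move=> U phi u e par Uu frame; have [oU sphi _ _ _] := par.
apply: (quadric_minimal kE QT QQ trQ oU sphi _ _ Uu frame) => w.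
  by move=> /(XE _ _ _ par)[].
by move=> /(XE _ _ _ par)[].
Qed.

Lemma clifford_torus_SCDK_ideal :
  SCDK_ideal (p + q) 1 {: 'cV[R]_(p.+1 + q.+1)}%VS X idfun.
Proof.
split; first exact: clifford_torus_minimal.
move=> U phi u e nu par Uu frame onu; have [oU sphi _ _ _] := par.
have XE w : U w -> dot (phi w) (phi w) = 1 /\ dot (phi w) (Q *m phi w) = 0.
  by move/(parametrization_in par); rewrite /X clifford_torusE.
(* In codimension one the sum is the single eigenvalue [n], and the second eigenvalue is the default
   [0] of the one-element list. *)
exists (nseq 1 (p + q)%:R); last first.
  by rewrite (minn_idPr n_gt0) big_nat1 /= addr0.
rewrite (quadric_fundamental_matrix kE QT QQ trQ oU sphi _ _ Uu frame onu).
- exact: spectrum_scalar.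
- by move=> w /XE[].
- by move=> w /XE[].
Qed.

End CliffordTorus.

(** * Veronese manifolds *)

Section VeroneseManifold.
Variables (R : realType) (n : nat).
Hypothesis n_gt1 : (1 < n)%N.

Let n_gt0 : (0 < n)%N. Proof. exact: ltnW. Qed.

Let X : set 'cV[R]_n.+1 := sphere n (veronese_radius R n).
Let m := ((n * (n + 3))./2 - n.+1)%N.

Let r2_gt0 : 0 < (2 * n.+1)%:R / n%:R :> R.
Proof. by rewrite divr_gt0// ltr0n. Qed.

Let XE : X = [set x | dot x x = (2 * n.+1)%:R / n%:R].
Proof. by rewrite /X sphereE// ltW. Qed.

(** Of the dimension of the symmetric matrices, the trace condition and the unit sphere take one
    each. The bound on [n.+1] makes the truncated subtraction in [m] exact. *)
Let dimE : ('C(n.+2, 2) = (n + m).+2)%N.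
Proof.
rewrite bin2 /m.
have -> : (n.+2 * n.+2.-1 = (n * (n + 3)).+2)%N by rewrite /=; nia.
rewrite /=; have : ((n.+1).*2 <= n * (n + 3))%N by rewrite -muln2; nia.
by move/half_leq; rewrite doubleK; lia.
Qed.

(** Equivalent to [(n - 2) (n + 1) >= 0], with equality at [n = 2]. *)
Let le_nm : (n <= m)%N.
Proof.
rewrite /m; have : ((n + n.+1).*2 <= n * (n + 3))%N by rewrite -muln2; nia.
by move/half_leq; rewrite doubleK; lia.
Qed.

Lemma veronese_minimal_submanifold :
  minimal_submanifold n m (sym0 R n.+1) X (veronese R n).
Proof.
have phiX (U : set 'cV[R]_n) phi w : parametrization X U phi -> U w ->
    dot (phi w) (phi w) = (2 * n.+1)%:R / n%:R.
  by move=> par /(parametrization_in par); rewrite XE.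
split; first split.
- by have := dim_sym0 R n; rewrite dimE => -[].
- move=> x; rewrite XE => xx.
  have [G [phi [g [c Gx]]]] := sphere_chart r2_gt0 xx.
  exists setT, phi; split; first exact: chart_parametrization c.
  by have [_ _ _ _ gK] := c; exists (g x) => //; exact: gK.
- move=> x; rewrite XE => xx; split; last exact: veronese_norm.
  by apply/mem_sym0; split; [exact: veronese_tr|exact: veronese_mxtrace].
- move=> U phi par; have [oU sphi inj _ _] := par.
  split; first exact: smooth_on_veronese.
  move=> u Uu; apply: (veronese_immersive n_gt0 oU sphi _ Uu (inj _ Uu)).
  by move=> w; exact: phiX par.
move=> U phi u e par Uu frame; have [oU sphi _ _ _] := par.
apply: (veronese_minimal n_gt0 oU sphi _ Uu frame) => w.
exact: phiX par.
Qed.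

Lemma veronese_SCDK_ideal : SCDK_ideal n m (sym0 R n.+1) X (veronese R n).
Proof.
split; first exact: veronese_minimal_submanifold.
move=> U phi u e nu par Uu frame onu; have [oU sphi _ _ _] := par.
exists (nseq m (n%:R / n.+1%:R)).
  rewrite (veronese_fundamental_matrix n_gt0 oU sphi _ Uu frame onu).
    exact: spectrum_scalar.
  by move=> w /(parametrization_in par); rewrite XE.
(* All [n] summands and the second eigenvalue lie within the list, giving [n + 1] copies of
   [n / (n + 1)]. *)
rewrite (minn_idPl le_nm) nth_nseq (leq_trans n_gt1 le_nm) big_mkord.
rewrite (eq_bigr (fun=> n%:R / n.+1%:R)) => [|i _]; last first.
  by rewrite nth_nseq (leq_trans (ltn_ord i) le_nm).
by rewrite sumr_const card_ord -mulrSr -[LHS]mulr_natr mulfVK// pnatr_eq0.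
Qed.

End VeroneseManifold.

Theorem theorem3p3 (R : realType) :
  (forall p q : nat, (1 <= p)%N -> (p <= q)%N ->
    [/\ compact (clifford_torus R p q),
        minimal_submanifold (p + q) 1 {: 'cV[R]_(p.+1 + q.+1)}%VS
          (clifford_torus R p q) idfun &
        SCDK_ideal (p + q) 1 {: 'cV[R]_(p.+1 + q.+1)}%VS
          (clifford_torus R p q) idfun]) /\
  (forall n : nat, (2 <= n)%N ->
    [/\ compact (sphere n (veronese_radius R n)),
        minimal_submanifold n ((n * (n + 3))./2 - n.+1)%N (sym0 R n.+1)
          (sphere n (veronese_radius R n)) (veronese R n) &
        SCDK_ideal n ((n * (n + 3))./2 - n.+1)%N (sym0 R n.+1)
          (sphere n (veronese_radius R n)) (veronese R n)]).
Proof.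
split=> [p q p_gt0 le_pq|n n_gt1].
  have q_gt0 : (0 < q)%N by exact: leq_trans le_pq.
  split; first exact: clifford_torus_compact.
    exact: clifford_torus_minimal.
  exact: clifford_torus_SCDK_ideal.
split; last exact: veronese_SCDK_ideal.
  by rewrite sphereE ?divr_ge0//; exact: compact_dot_eq.
exact: veronese_minimal_submanifold.
Qed.
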